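(* Let $\alpha>0$ be fixed, let $\ell\ge 3$ be a fixed integer, and let $p=p(n)$ satisfy $p=\omega(n^{-(\ell-1)/\ell})$, i.e. $p(n)\,n^{(\ell-1)/\ell}\to\infty$. For each $n$ let $G_\alpha=G_\alpha(n)$ be any $n$-vertex graph on vertex set $[n]$ with minimum degree $\delta(G_\alpha)\ge\alpha n$. Then asymptotically almost surely (i.e. with probability tending to $1$ as $n\to\infty$) the graph $G_\alpha\cup G(n,p)$ is $\mathcal{F}^{\ell}(n,2)$-universal.
   Context: $G(n,p)$ denotes the binomial random graph on vertex set $[n]$ in which each pair of vertices is an edge independently with probability $p$; $G_\alpha\cup G(n,p)$ is the graph on $[n]$ whose edge set is the union of the two edge sets. $\mathcal{F}^\ell(n,2)$ is the family of all $n$-vertex graphs with maximum degree at most $2$ and girth at least $\ell$ (i.e. containing no cycle of length less than $\ell$). A graph $G$ is $\mathcal{F}$-universal if it contains every $F\in\mathcal{F}$ as a (not necessarily induced) subgraph. *)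

(* Defs.v *)
From HB Require Import structures.
From mathcomp Require Import all_boot all_order all_algebra.
From mathcomp Require Import all_classical all_reals all_analysis.
Set Implicit Arguments.
Unset Strict Implicit.
Unset Printing Implicit Defensive.
Import Order.TTheory GRing.Theory Num.Theory.

Definition pairs (T : finType) : {set {set T}} := finset (fun e : {set T} => #|e| == 2).

Record graph (n : nat) := Graph {
  edges : {set {set 'I_n}};
  edges_pairs : edges \subset pairs 'I_n }.

HB.instance Definition _ n := [isSub for @edges n].
HB.instance Definition _ n := [Finite of graph n by <:].

Section Graphs.
Variable n : nat.
Implicit Types (F G H : graph n) (u v : 'I_n) (c : seq 'I_n).

(* Irreflexive, since [set u; u] is a singleton and hence never an edge. *)
Definition adj G : rel 'I_n := fun u v => [set u; v]%SET \in edges G.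

Definition degree G v := #|adj G v|.

Definition max_degree G := \max_(v : 'I_n) degree G v.

(* All degrees are smaller than n, so the default value n only matters when
   there is no vertex, that is, when n = 0 (and then the value is 0). *)
Definition min_degree G := \big[minn/n]_(v : 'I_n) degree G v.

Lemma union_pairs G H : edges G :|: edges H \subset pairs 'I_n.
Proof. by rewrite finset.subUset !edges_pairs. Qed.

Definition graph_union G H := Graph (union_pairs G H).

(* The size condition is needed: ucycle holds of [::], and of [:: u; v] for
   every edge uv. *)
Definition is_cycle G c := (3 <= size c) && ucycleb (adj G) c.

Definition girth_ge l G := forall c, is_cycle G c -> l <= size c.

Definition contains G F :=
  exists2 f : 'I_n -> 'I_n, injective f &
    forall u v, adj F u v -> adj G (f u) (f v).

Definition universal (Fam : set (graph n)) G := forall F, Fam F -> contains G F.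

End Graphs.

(* The family F^l(n,2), with [n] as vertex set. *)
Definition family2 (l n : nat) : set (graph n) :=
  fun F => max_degree F <= 2 /\ girth_ge l F.
Arguments family2 l n : clear implicits.

Local Open Scope ring_scope.

(* The law of G(n,p): the product over all pairs of Bernoulli(p) laws. *)
Definition gnp_mass (R : realType) (n : nat) (p : R) (H : graph n) : R :=
  \prod_(e in pairs 'I_n) (if e \in edges H then p else 1 - p).

Definition gnp_prob (R : realType) (n : nat) (p : R) (A : set (graph n)) : R :=
  \sum_(H : graph n | `[< A H >]) gnp_mass p H.

(* Main.v *)
Require Import Defs.
From mathcomp Require Import all_boot all_order all_fingroup all_algebra.
From mathcomp Require Import all_classical all_reals all_analysis.
From mathcomp Require Import zify ring lra.
Import Order.TTheory GRing.Theory Num.Theory.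
Import numFieldNormedType.Exports.
Local Open Scope ring_scope.

(* Let N(v) be the G_alpha-neighbourhood of v, of size at least n/a.

   In the random graph H, any s >= l sets of linear size have a transversal
   s-cycle, with failure probability e^(-n): apply Janson's argument after
   lowering p to C n^(-1+1/s), where the expected number of such cycles is still
   a large multiple of n, and take the union bound over the 2^(sn) choices of the
   sets.  Hence H contains linearly many disjoint k-cycles.  Since G(n,p) is
   invariant under relabelling, these may be taken to be in random position, so
   that for all v and z linearly many of the paths b a c on them satisfy
   b, c in N(v) and a in N(z).  Such a path is a gadget: a can be replaced by v,
   and becomes available for a position next to z.

   F consists of cycles of length at least l and of paths.  It has either many
   cycles of one bounded length, which are mapped onto gadget cycles, or many
   vertices on long cycles, in which case gadgets are placed on pieces of these.
   Long cycles are then cut into pieces of bounded length, whose ends have to be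
   joined by G_alpha-edges to vertices embedded beforehand.  The remaining short
   cycles and pieces are embedded one by one by transversal cycles of H.  The end
   of a piece, as well as each of the last few vertices of F, takes the place of
   the centre a of a gadget, which moves to an unused vertex v. *)

(** * Random subsets *)

(** Gadgets supply linear target sets in both, but each such placement uses one up. This makes the
    constants circular: with n/e usable gadgets for each pair v, z, the up to 2n/D ends of pieces
    force D to be a large multiple of e, whereas gadgets on pieces of length about D become rarer as
    D grows if each piece carries only one. Hence a gadget piece contains a path of length k
    comparable to D with about k/4 gadgets on it; then e depends on alpha only, and k and D can be
    chosen afterwards. If whole cycles of one bounded length carry the gadgets, D is not tied to
    them and is chosen last. Relabelling is what makes the gadgets of a fixed [H] random relative to
    [G_alpha]; there a union bound over the pairs v, z is enough, while transversality has to beat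
    2^(sn). *)

Section RandomSubset.
Import mathcomp.boot.fintype mathcomp.boot.finset.
Local Set Implicit Arguments.
Local Unset Strict Implicit.
Local Unset Printing Implicit Defensive.
Variables (R : realType) (T : finType).
Implicit Types (p : R) (D S A : {set T}) (phi psi : {set T} -> R).

(** The expectation of [phi] at the random subset of [D] that keeps each element independently with
    probability [p]. Allowing any [D] makes induction on the ground set possible, one element at a
    time. *)
Definition pE p D phi : R :=
  \sum_(S in powerset D) (\prod_(e in D) (if e \in S then p else 1 - p)) * phi S.

Lemma ler_bool (a b : bool) : (a -> b) -> a%:R <= b%:R :> R.
Proof. by case: a b => [] [] // /(_ isT). Qed.

Lemma eq_pE p D phi psi :
  (forall S, S \subset D -> phi S = psi S) -> pE p D phi = pE p D psi.
Proof. by move=> h; apply: eq_bigr => S; rewrite powersetE => /h ->. Qed.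

Lemma pE0 p phi : pE p set0 phi = phi set0.
Proof. by rewrite /pE powerset0 big_set1 big_set0 mul1r. Qed.

Lemma pE_setU1 p D e phi : e \notin D ->
  pE p (e |: D) phi = p * pE p D (fun S => phi (e |: S)) + (1 - p) * pE p D phi.
Proof.
move=> eD; rewrite /pE (bigID (fun S : {set T} => e \in S)) /=; congr (_ + _).
- rewrite (reindex_onto (fun S => e |: S) (fun S => S :\ e)) /=; last first.
    by move=> S /andP[_ eS]; rewrite setD1K.
  rewrite mulr_sumr; apply: eq_big => [S|S].
    rewrite !powersetE setU11 andbT; apply/andP/idP => [[sSD /eqP <-]|sSD].
      by rewrite subDset.
    by rewrite setUS //; split=> //; rewrite setU1K // (contra (subsetP sSD e)).
  move=> /andP[_ /eqP hS]; rewrite mulrA big_setU1 //= setU11; congr (_ * _ * _).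
  apply: eq_bigr => f fD; rewrite in_setU1.
  by case: eqP => // fe; rewrite -fe fD in eD.
- rewrite mulr_sumr; apply: eq_big => [S|S].
    rewrite !powersetE; apply/andP/idP => [[sSD eS]|sSD].
      apply/subsetP => x xS; have := subsetP sSD x xS; rewrite in_setU1.
      by case/predU1P => // xe; rewrite -xe xS in eS.
    split; first by rewrite (subset_trans sSD) // subsetU1.
    by apply: contra eD => /(subsetP sSD).
  by move=> /andP[_ /negbTE eS]; rewrite mulrA big_setU1 //= eS.
Qed.

Lemma set_ind_card (P : {set T} -> Prop) :
  P set0 -> (forall e D, e \notin D -> P D -> P (e |: D)) -> forall D, P D.
Proof.
move=> P0 PS D; elim: {D}#|D| {-2}D (erefl #|D|) => [D /eqP|m IH D hD].
  by rewrite cards_eq0 => /eqP ->.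
have /card_gt0P[e eD] : (0 < #|D|)%N by rewrite hD.
rewrite -(setD1K eD); apply: PS; first by rewrite !inE eqxx.
by apply: IH; move: hD; rewrite (cardsD1 e) eD => -[].
Qed.

Lemma pE_cst p D c : pE p D (fun=> c) = c.
Proof.
elim/set_ind_card: D => [|e D eD IH]; first exact: pE0.
by rewrite pE_setU1 // IH; ring.
Qed.

Lemma pED p D phi psi : pE p D (fun S => phi S + psi S) = pE p D phi + pE p D psi.
Proof. by rewrite /pE -big_split; apply: eq_bigr => S _; rewrite mulrDr. Qed.

Lemma pEN p D phi : pE p D (fun S => - phi S) = - pE p D phi.
Proof. by rewrite /pE -sumrN; apply: eq_bigr => S _; rewrite mulrN. Qed.

Lemma pE_sum p D (I : Type) (r : seq I) (P : pred I) (phi : I -> {set T} -> R) :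
  pE p D (fun S => \sum_(i <- r | P i) phi i S) = \sum_(i <- r | P i) pE p D (phi i).
Proof. by rewrite /pE exchange_big; apply: eq_bigr => S _; rewrite mulr_sumr. Qed.

Lemma le_pE p D phi psi : 0 <= p <= 1 ->
  (forall S, S \subset D -> phi S <= psi S) -> pE p D phi <= pE p D psi.
Proof.
move=> /andP[p0 p1] h; apply: ler_sum => S; rewrite powersetE => /h hS.
apply: ler_wpM2l => //; apply: prodr_ge0 => e _; case: ifP => // _.
by rewrite subr_ge0.
Qed.

(** Induction on [D] in place of a coupling: the increasing [phi] has the larger expectation when
    [e] is present, and [q] gives that case more weight. *)
Lemma le_pE_mono p q D phi : 0 <= p -> p <= q -> q <= 1 ->
  (forall S S', S \subset S' -> phi S <= phi S') -> pE p D phi <= pE q D phi.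
Proof.
move=> p0 pq q1; elim/set_ind_card: D phi => [phi _|e D eD IH phi hphi].
  by rewrite !pE0.
rewrite !pE_setU1 //.
have h1 : pE p D (fun S => phi (e |: S)) <= pE q D (fun S => phi (e |: S)).
  by apply: IH => S S' sS; apply: hphi; rewrite setUS.
have h0 := IH phi hphi.
have h01 : pE q D phi <= pE q D (fun S => phi (e |: S)).
  by apply: le_pE => [|S _]; [lra|apply: hphi; rewrite subsetU1].
by nra.
Qed.

Lemma pE_mem p D e phi : e \in D ->
  pE p D (fun S => (e \in S)%:R * phi S) = p * pE p D (fun S => phi (e |: S)).
Proof.
move=> eD; rewrite -(setD1K eD); set D' := D :\ e.
have eD' : e \notin D' by rewrite !inE eqxx.
rewrite !pE_setU1 //.
rewrite (@eq_pE p D' _ (fun S => phi (e |: S))); last first.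
  by move=> S _; rewrite setU11 mul1r.
rewrite (@eq_pE p D' (fun S => (e \in S)%:R * phi S) (fun=> 0)); last first.
  move=> S sS; case: (boolP (e \in S)) => [|_]; last by rewrite mul0r.
  by move/(subsetP sS); rewrite (negbTE eD').
rewrite (@eq_pE p D' (fun S => phi (e |: (e |: S))) (fun S => phi (e |: S))).
  by rewrite pE_cst; ring.
by move=> S _; rewrite setUA setUid.
Qed.

Lemma pE_subset p D A phi : A \subset D ->
  pE p D (fun S => (A \subset S)%:R * phi S) =
  p ^+ #|A| * pE p D (fun S => phi (A :|: S)).
Proof.
elim/set_ind_card: A phi => [phi _|e A eA IH phi sAD].
  rewrite cards0 expr0 mul1r; apply: eq_pE => S _.
  by rewrite sub0set mul1r set0U.
move: sAD; rewrite subUset sub1set => /andP[eD sAD].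
rewrite (@eq_pE p D _ (fun S => (e \in S)%:R * ((A \subset S)%:R * phi S))); last first.
  by move=> S _; rewrite subUset sub1set mulrA -natrM mulnb.
rewrite pE_mem //.
rewrite (@eq_pE p D _ (fun S => (A \subset S)%:R * phi (e |: S))); last first.
  move=> S _; rewrite -subDset (_ : A :\: [set e] = A) //.
  by apply/setP => x; rewrite !inE; case: eqP => // ->; rewrite (negbTE eA).
rewrite IH // cardsU1 eA exprD expr1 mulrA; congr (_ * _).
by apply: eq_pE => S _; rewrite setUA.
Qed.

(* The lower-tail argument behind Janson's inequality. Conditioning on [Sf i]
   being present just adds [Sf i] to the random set, which leaves untouched the
   events on sets disjoint from [Sf i] and can only destroy "avoiding" events;
   hence no correlation inequality is needed. *)
Lemma janson (I : eqType) p D (s : nat) (Sf : I -> {set T}) (r : seq I) :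
  0 <= p <= 1 -> uniq r -> {in r, forall i, Sf i \subset D} -> {in r, forall i, #|Sf i| = s} ->
  (forall i, i \in r ->
     \sum_(j <- r | (j != i) && ~~ [disjoint Sf i & Sf j]) p ^+ #|Sf i :|: Sf j|
       <= p ^+ s / 2) ->
  pE p D (fun S => (all (fun j => ~~ (Sf j \subset S)) r)%:R)
    <= (1 - p ^+ s / 2) ^+ size r.
Proof.
move=> p01; elim: r => [_ _ _ _|i r IH /= /andP[ir ur] sD cS hdep].
  by rewrite /= expr0 (@eq_pE _ _ _ (fun=> 1)) ?pE_cst.
have [p0 p1] := andP p01.
have ps1 : p ^+ s <= 1 by rewrite exprn_ile1.
have ps0 : 0 <= p ^+ s by rewrite exprn_ge0.
pose av (q : seq I) (S : {set T}) : R := (all (fun j => ~~ (Sf j \subset S)) q)%:R.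
have {}IH : pE p D (av r) <= (1 - p ^+ s / 2) ^+ size r.
  have sub k : k \in r -> k \in i :: r by rewrite inE => ->; rewrite orbT.
  apply: IH => // k kr; have kir := sub k kr; [exact: sD|exact: cS|].
  apply: le_trans (hdep k kir); rewrite big_cons.
  by case: ifP => // _; rewrite lerDr exprn_ge0.
(* The members of [r] on which adding [Sf i] to the random set has no effect. *)
pose ind := [seq j <- r | [disjoint Sf i & Sf j]].
have av_sub S : av r S <= av ind S.
  apply: ler_bool => /allP h; apply/allP => j.
  by rewrite mem_filter => /andP[_ /h].
(* A union bound over the members meeting [Sf i]: if [ind] is avoided but [r] is not, one of them is
   contained in [S]. *)
have av_ge S : av ind S - \sum_(j <- r | ~~ [disjoint Sf i & Sf j])
     (Sf j \subset S)%:R * av ind S <= av r S.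
  have sum0 : 0 <= \sum_(j <- r | ~~ [disjoint Sf i & Sf j]) (Sf j \subset S)%:R * av ind S.
    by apply: sumr_ge0 => j _; rewrite mulr_ge0.
  rewrite {3}/av; case: (boolP (all (fun j => ~~ (Sf j \subset S)) r)) => [_|/allPn[j jr]].
    rewrite lerBlDr (@le_trans _ _ 1) ?lerDl //.
    by rewrite /av lern1 leq_b1.
  rewrite negbK subr_le0 => sj.
  case: (boolP [disjoint Sf i & Sf j]) => hij.
    rewrite {1}/av (_ : all _ _ = false) //; apply/negbTE/allPn; exists j.
      by rewrite mem_filter hij jr.
    by rewrite negbK.
  rewrite (big_rem j) //= hij sj mul1r lerDl; apply: sumr_ge0 => k _.
  by rewrite mulr_ge0.
(* Restricted to the presence of [Sf i], [av_ge] gives p^s times the probability of avoiding [ind],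
   minus an overlap sum that by hypothesis is at most half of it; and avoiding [ind] is at least as
   likely as avoiding [r]. *)
have key : p ^+ s / 2 * pE p D (av r) <= pE p D (fun S => (Sf i \subset S)%:R * av r S).
  apply: (@le_trans _ _ (p ^+ s / 2 * pE p D (av ind))).
    by rewrite ler_wpM2l ?divr_ge0 //; apply: le_pE.
  apply: (@le_trans _ _ (pE p D (fun S => (Sf i \subset S)%:R * av ind S)
     - \sum_(j <- r | ~~ [disjoint Sf i & Sf j])
         pE p D (fun S => (Sf i :|: Sf j \subset S)%:R * av ind S))); last first.
    rewrite -pE_sum -pEN -pED; apply: le_pE => // S _.
    have hav := av_ge S; case: (boolP (Sf i \subset S)) => si; last first.
      rewrite !mul0r big1 ?subrr // => j _.
      by rewrite subUset (negbTE si) mul0r.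
    rewrite !mul1r; apply: le_trans hav; rewrite lerD2l lerN2.
    by apply: ler_sum => j _; rewrite subUset si.
  rewrite pE_subset ?cS ?sD ?mem_head //.
  have -> : pE p D (fun S => av ind (Sf i :|: S)) = pE p D (av ind).
    apply: eq_pE => S _; rewrite /av; congr (_%:R); congr nat_of_bool.
    apply: eq_in_all => j; rewrite mem_filter => /andP[dij _].
    by rewrite -subDset (_ : Sf j :\: Sf i = Sf j) //; apply/setDidPl; rewrite disjoint_sym.
  have hs : \sum_(j <- r | ~~ [disjoint Sf i & Sf j])
         pE p D (fun S => (Sf i :|: Sf j \subset S)%:R * av ind S) <=
      p ^+ s / 2 * pE p D (av ind).
    apply: (@le_trans _ _ (\sum_(j <- r | ~~ [disjoint Sf i & Sf j])
        p ^+ #|Sf i :|: Sf j| * pE p D (av ind))).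
      rewrite [leLHS]big_seq_cond [leRHS]big_seq_cond; apply: ler_sum => j /andP[jr _].
      rewrite pE_subset ?subUset ?sD ?mem_head ?inE ?jr ?orbT //.
      rewrite ler_wpM2l ?exprn_ge0 //; apply: le_pE => // S _.
      apply: ler_bool => /allP h; apply/allP => k /h.
      by apply: contra => /subset_trans; apply; rewrite subsetUr.
    rewrite -mulr_suml ler_wpM2r //.
      by rewrite -(pE_cst p D 0); apply: le_pE.
    have := hdep i (mem_head _ _); rewrite big_cons eqxx /=; apply: le_trans.
    rewrite [leRHS]big_mkcond [leLHS]big_mkcond.
    rewrite !big_seq; apply: ler_sum => j jr.
    by rewrite (_ : j != i) //; apply: contraNneq ir => <-.
  by move: hs; move: (\sum_(_ <- _ | _) _) => X; lra.
rewrite /= exprS.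
have -> : pE p D (fun S => (~~ (Sf i \subset S) && all (fun j => ~~ (Sf j \subset S)) r)%:R)
   = pE p D (av r) - pE p D (fun S => (Sf i \subset S)%:R * av r S).
  rewrite -pEN -pED; apply: eq_pE => S _; rewrite /av.
  by case: (Sf i \subset S); rewrite /= ?mul1r ?mul0r ?subrr ?subr0.
apply: le_trans (_ : (1 - p ^+ s / 2) * pE p D (av r) <= _).
  by move: key; lra.
by rewrite ler_wpM2l //; lra.
Qed.

End RandomSubset.

(** * Transversal cycles in given sets *)

Section Transversal.
Import mathcomp.boot.fintype mathcomp.boot.finset.
Local Set Implicit Arguments.
Local Unset Strict Implicit.
Local Unset Printing Implicit Defensive.
Implicit Types (n s w : nat).

Lemma exists_subset_card (T : finType) (A : {set T}) w :
  (w <= #|A|)%N -> exists2 B : {set T}, B \subset A & #|B| = w.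
Proof.
move=> hw; exists [set x in take w (enum A)].
  by apply/subsetP => x; rewrite inE => /mem_take; rewrite mem_enum.
rewrite cardsE (card_uniqP _) ?take_uniq ?enum_uniq //.
by rewrite size_take -cardE; case: ltngtP hw.
Qed.

(** Greedy choice: the sets chosen earlier remove at most (s - 1) w elements. *)
Lemma disjoint_sublists (T : finType) (W : nat -> {set T}) s w :
  (forall j, (j < s)%N -> (s * w <= #|W j|)%N) ->
  exists W' : nat -> {set T},
    forall j, (j < s)%N -> [/\ W' j \subset W j, #|W' j| = w
      & forall i, (i < j)%N -> [disjoint W' i & W' j]].
Proof.
move=> hW.
suff : forall k, (k <= s)%N -> exists W' : nat -> {set T},
    forall j, (j < k)%N -> [/\ W' j \subset W j, #|W' j| = w
      & forall i, (i < j)%N -> [disjoint W' i & W' j]] by apply.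
elim=> [_|k IH ks]; first by exists (fun=> set0).
have [W' hW'] := IH (ltnW ks).
pose U := \bigcup_(i < k) W' i.
have cU : forall m, (m <= k)%N -> (#|\bigcup_(i < m) W' i| <= m * w)%N.
  elim=> [_|m IHm mk]; first by rewrite big_ord0 cards0.
  rewrite big_ord_recr /= (leq_trans (leq_card_setU _ _)) // mulSn addnC.
  by have [_ -> _] := hW' m mk; rewrite leq_add2l; apply: IHm; apply: ltnW.
have {}cU : (#|U| <= k * w)%N by apply: cU.
have [|B sB cB] := @exists_subset_card T (W k :\: U) w.
  rewrite cardsD; have := hW _ ks; have := subset_leq_card (subsetIr (W k) U).
  by nia.
exists (fun j => if j == k then B else W' j) => j.
rewrite ltnS leq_eqVlt => /predU1P[->|jk].
  rewrite eqxx; split=> //; first by rewrite (subset_trans sB) // subsetDl.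
  move=> i ik; rewrite ltn_eqF // disjoint_sym (disjointWl sB) //.
  rewrite disjoints_subset setDE subIset // setCS orbC.
  by rewrite (bigcup_sup (Ordinal ik)).
rewrite (ltn_eqF jk); have [h1 h2 h3] := hW' j jk; split=> // i ij.
by rewrite (ltn_eqF (ltn_trans ij jk)) h3.
Qed.

Lemma iter_ordS s (i : 'I_s) k : (iter k (@ordS s) i : nat) = ((i + k) %% s)%N.
Proof.
elim: k => [|k IH] /=; first by rewrite addn0 modn_small.
by rewrite IH -addn1 modnDml addn1 addnS.
Qed.

Lemma ordS_neq s (i : 'I_s) : (1 < s)%N -> ordS i != i.
Proof.
move=> s1; rewrite -val_eqE /=; have := ltn_ord i; rewrite leq_eqVlt.
case/predU1P => [e|h]; last by rewrite modn_small // gtn_eqF.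
by rewrite e modnn; lia.
Qed.

Lemma ordSS_neq s (i : 'I_s) : (2 < s)%N -> ordS (ordS i) != i.
Proof.
move=> s2; rewrite -val_eqE; have := iter_ordS i 2; rewrite /= => ->.
have := ltn_ord i => hi; case: (ltnP (i + 2) s) => h.
  by rewrite modn_small //; lia.
have -> : (i + 2 = (i + 2 - s) + s)%N by lia.
by rewrite modnDr modn_small; lia.
Qed.

Lemma ordS_closed s (A : {set 'I_s}) (i : 'I_s) :
  i \in A -> (forall j, j \in A -> ordS j \in A) -> A = setT.
Proof.
move=> iA hA; apply/setP => j; rewrite inE.
have -> : j = iter (j + s - i) (@ordS s) i.
  apply/val_inj; rewrite /= iter_ordS; have := ltn_ord i; have := ltn_ord j => h1 h2.
  have -> : (i + (j + s - i) = j + s)%N by lia.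
  by rewrite modnDr modn_small.
by elim: (j + s - i)%N => [|k IH] //=; apply: hA.
Qed.

(** * Overlaps of transversal cycles *)

Section CycleJanson.
Variables (R : realType) (n s w : nat) (W : 'I_s -> {set 'I_n}) (p : R).
Hypothesis s3 : (3 <= s)%N.
Hypothesis Wdisj : forall i j, i != j -> [disjoint W i & W j].
Hypothesis Wcard : forall i, #|W i| = w.

Let fam := [set x : {ffun 'I_s -> 'I_n} | [forall i, x i \in W i]].
Definition cyc_edge (x : {ffun 'I_s -> 'I_n}) (i : 'I_s) : {set 'I_n} := [set x i; x (ordS i)].
Definition cyc_edges x := [set cyc_edge x i | i : 'I_s].
Let agree (x y : {ffun 'I_s -> 'I_n}) := [set i | x i == y i].

Let famP x : x \in fam -> forall i, x i \in W i.
Proof. by rewrite inE => /forallP. Qed.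

Let fam_idx x y i j : x \in fam -> y \in fam -> x i = y j -> i = j.
Proof.
move=> xf yf e; apply/eqP/negPn/negP => /Wdisj.
by rewrite disjoints_subset => /subsetP/(_ _ (famP xf i)); rewrite inE e (famP yf).
Qed.

(** As the sets [W i] are disjoint, a vertex determines its position. Equal edges read in opposite
    directions would force [ordS (ordS i) = i], which [s3] excludes. *)
Let cyc_edge_eq x y i j : x \in fam -> y \in fam -> cyc_edge x i = cyc_edge y j ->
  [/\ i = j, x i = y i & x (ordS i) = y (ordS i)].
Proof.
move=> xf yf e.
have : x i \in cyc_edge y j by rewrite -e !inE eqxx.
have : x (ordS i) \in cyc_edge y j by rewrite -e !inE eqxx orbT.
rewrite !inE => /orP[]/eqP h1 /orP[]/eqP h2.
- have hj := fam_idx xf yf h2; move: h1; rewrite hj => /(fam_idx xf yf)/eqP.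
  by rewrite (negbTE (ordS_neq _ _)) // ltnW.
- have := fam_idx xf yf h1; rewrite (fam_idx xf yf h2) => /eqP.
  by rewrite (negbTE (ordSS_neq _ _)).
- by have hj := fam_idx xf yf h2; rewrite -hj in h1 h2 *.
- have hi := fam_idx xf yf h2; move/(fam_idx xf yf): h1; rewrite -hi => /eqP.
  by rewrite (negbTE (ordS_neq _ _)) // ltnW.
Qed.

Let card_cyc_edges x : x \in fam -> #|cyc_edges x| = s.
Proof.
move=> xf; rewrite card_imset ?card_ord // => i j h.
by have [] := cyc_edge_eq xf xf h.
Qed.

Let cyc_edges_pairs x : x \in fam -> cyc_edges x \subset pairs 'I_n.
Proof.
move=> xf; apply/subsetP => e /imsetP[i _ ->]; rewrite inE cards2.
suff -> : x i != x (ordS i) by [].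
apply/eqP => /(fam_idx xf xf)/eqP; rewrite eq_sym.
by rewrite (negbTE (ordS_neq _ _)) // ltnW.
Qed.

(** A shared edge sits at a position that lies in [agree x y] together with its successor. Were this
    set closed under successor, it would be everything and [x = y]; so there are strictly fewer
    shared edges than agreements, just as a proper subgraph of a cycle is a forest. *)
Let card_inter x y : x \in fam -> y \in fam -> y != x ->
  (#|cyc_edges x :&: cyc_edges y| > 0)%N ->
  [/\ (2 <= #|agree x y|)%N, (#|agree x y| < s)%N
    & (#|cyc_edges x :&: cyc_edges y| <= #|agree x y| - 1)%N].
Proof.
move=> xf yf neq hI; set A := agree x y.
pose B := [set i in A | ordS i \in A].
have sIB : cyc_edges x :&: cyc_edges y \subset [set cyc_edge x i | i in B].
  apply/subsetP => e; rewrite inE => /andP[/imsetP[i _ ->] /imsetP[j _ h]].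
  have [_ h1 h2] := cyc_edge_eq xf yf h.
  by apply/imsetP; exists i => //; rewrite !inE h1 h2 !eqxx.
have cIB : (#|cyc_edges x :&: cyc_edges y| <= #|B|)%N.
  by rewrite (leq_trans (subset_leq_card sIB)) // leq_imset_card.
have AT : A != setT.
  apply: contra neq => /eqP/setP h; apply/eqP/ffunP => i.
  by have := h i; rewrite !inE => /eqP.
have cA : (#|A| < s)%N.
  rewrite -[s in (_ < s)%N]card_ord -cardsT proper_card //.
  by rewrite properT.
have BA : (#|B| < #|A|)%N.
  apply/proper_card/properP; split; first by apply/subsetP => i; rewrite inE => /andP[].
  have /card_gt0P[i0 i0B] : (0 < #|B|)%N by apply: leq_trans cIB.
  case: (boolP [exists i in A, ordS i \notin A]) => [/existsP[i /andP[iA iN]]|].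
    by exists i => //; rewrite inE iA.
  rewrite negb_exists => /forallP h; case/eqP: AT.
  apply: (@ordS_closed s A i0); first by move: i0B; rewrite inE => /andP[].
  by move=> j jA; have := h j; rewrite jA /= negbK.
split=> //; first by apply: leq_trans BA; rewrite ltnS (leq_trans hI).
by rewrite (leq_trans cIB) // leq_subRL; lia.
Qed.

Let card_family_agree x (A : {set 'I_s}) : x \in fam ->
  (#|[set y in fam | agree x y == A]| <= w ^ (s - #|A|))%N.
Proof.
move=> xf.
pose F (i : 'I_s) := if i \in A then [set x i] else W i.
apply: (@leq_trans #|(family (fun i => [pred z | z \in F i]) : simpl_pred {ffun 'I_s -> 'I_n})|).
  apply/subset_leq_card/subsetP => y; rewrite inE => /andP[yf /eqP e].
  apply/familyP => i; rewrite inE /= /F; case: ifP => iA; last exact: famP.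
  by move: iA; rewrite -e !inE => /eqP ->.
rewrite card_family foldrE big_map big_enum /=.
rewrite (bigID (mem A)) /= [X in (X * _)%N]big1 ?mul1n; last first.
  by move=> i iA; rewrite /F iA (eq_card (B := pred1 (x i))) ?card1 // => z; rewrite !inE.
rewrite (eq_bigr (fun=> w)) => [|i iA]; last first.
  by rewrite /F (negbTE iA) -(Wcard i); apply: eq_card => z.
rewrite prod_nat_const leq_eqVlt; apply/orP; left; apply/eqP; congr (_ ^ _)%N.
have := cardC (mem A); rewrite card_ord => e.
by apply/eqP; rewrite -(eqn_add2l #|A|) subnKC -1?[X in (_ <= X)%N]e ?leq_addr // -[X in _ == X]e.
Qed.

Hypothesis p01 : 0 <= p <= 1.
Hypothesis wp1 : 1 <= w%:R * p.
Hypothesis hsmall : 2 ^+ s * ((w%:R * p) ^+ (s - 2) * p) <= 2^-1.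

(** The cycles sharing an edge with [x] are grouped by the set A of positions where they agree with
    [x]. For |A| = k there are at most w^(s-k) of them, and the union with [x] has at least 2s + 1 -
    k edges, so the group contributes at most p^s p (wp)^(s-k). As wp >= 1, the worst case is k = 2,
    and [hsmall] makes the total over all 2^s sets A at most p^s / 2. *)
Lemma cycle_janson :
  pE p (pairs 'I_n) (fun S => (~~ [exists x : {ffun 'I_s -> 'I_n},
      [forall i, x i \in W i] && (cyc_edges x \subset S)])%:R)
   <= (1 - p ^+ s / 2) ^+ (w ^ s).
Proof.
have [p0 p1] := andP p01.
have sz : size (enum fam) = (w ^ s)%N.
  rewrite -cardE; have -> : #|fam| = #|(family (fun i => [pred z | z \in W i]) : simpl_pred {ffun 'I_s -> 'I_n})|.
    by apply: eq_card => x; rewrite inE; apply/forallP/familyP => h i; have := h i; rewrite inE.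
  rewrite card_family foldrE big_map big_enum /=.
  rewrite (eq_bigr (fun=> w)) ?prod_nat_const ?card_ord // => i _.
  by rewrite -(Wcard i); apply: eq_card => z.
rewrite -sz; apply: le_trans (janson (s := s) (Sf := cyc_edges) (D := pairs 'I_n) (r := enum fam) p01 _ _ _ _).
- apply: le_pE => // S _; apply: ler_bool => h; apply/allP => x; rewrite mem_enum => xf.
  apply: contra h => hx; apply/existsP; exists x; rewrite hx andbT.
  exact/forallP/famP.
- exact: enum_uniq.
- by move=> x; rewrite mem_enum; apply: cyc_edges_pairs.
- by move=> x; rewrite mem_enum; apply: card_cyc_edges.
move=> x; rewrite mem_enum => xf; rewrite big_enum_cond /=.
set q := p ^+ s * (p * (w%:R * p) ^+ (s - 2)).
have q0 : 0 <= q by rewrite !(mulr_ge0, exprn_ge0).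
have q1 : 2 ^+ s * q <= p ^+ s / 2.
  rewrite /q; have := ler_wpM2l (exprn_ge0 s p0) hsmall.
  by congr (_ <= _); ring.
apply: le_trans q1.
rewrite (partition_big (agree x) predT) //=.
have -> : 2 ^+ s * q = \sum_(A : {set 'I_s}) q.
  rewrite sumr_const cardE -cardE -(mulr_natl q) -natrX; congr (_%:R * _).
  by have := card_powerset [set: 'I_s]; rewrite cardsT card_ord => <-; apply: eq_card => A; rewrite !inE subsetT.
apply: ler_sum => A _.
case: (boolP ((2 <= #|A|)%N && (#|A| < s)%N)) => hA; last first.
  rewrite big1 // => y /andP[/andP[yf /andP[neq hd]] /eqP e].
  have [] := @card_inter x y xf yf neq; first by rewrite lt0n cards_eq0 setI_eq0.
  by rewrite e => h1 h2; rewrite h1 h2 in hA.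
apply: (@le_trans _ _ (\sum_(y in [set y in fam | agree x y == A]) p ^+ (2 * s + 1 - #|A|))).
  rewrite [leLHS]big_mkcond [leRHS]big_mkcond; apply: ler_sum => y _.
  rewrite inE; case: (boolP (y \in fam)) => //= yf.
  case: (agree x y =P A) => [e|_]; last by rewrite andbF.
  case: (boolP (y != x)) => [neq|_] /=; last by rewrite exprn_ge0.
  case: (boolP [disjoint _ & _]) => [_|hd] /=; first by rewrite exprn_ge0.
  have [] := @card_inter x y xf yf neq; first by rewrite lt0n cards_eq0 setI_eq0.
  rewrite e => h1 h2 h3; apply: ler_wiXn2l => //.
  rewrite cardsU (card_cyc_edges xf) (card_cyc_edges yf); move: h1 h2 h3.
  move: #|pred_of_set A| #|pred_of_set (_ :&: _)| => a i; lia.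
rewrite sumr_const -(mulr_natl (p ^+ _)).
apply: (@le_trans _ _ ((w ^ (s - #|A|))%:R * p ^+ (2 * s + 1 - #|A|))).
  by rewrite ler_wpM2r ?exprn_ge0 // ler_nat card_family_agree.
have [h1 h2] := andP hA.
have -> : (2 * s + 1 - #|A| = s + (1 + (s - #|A|)))%N by lia.
rewrite natrX !exprD expr1 /q.
rewrite (_ : _ * _ = p ^+ s * (p * (w%:R * p) ^+ (s - #|A|))); last first.
  by rewrite exprMn; ring.
rewrite ler_wpM2l ?exprn_ge0 // ler_wpM2l // ler_weXn2l //.
by lia.
Qed.

End CycleJanson.
End Transversal.

(** * The random graph *)

Section GnpBasics.
Import mathcomp.boot.fintype mathcomp.boot.finset.
Local Set Implicit Arguments.
Local Unset Strict Implicit.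
Local Unset Printing Implicit Defensive.
Variable R : realType.

Lemma pE_gnp (p : R) n (phi : {set {set 'I_n}} -> R) :
  pE p (pairs 'I_n) phi = \sum_(H : graph n) gnp_mass p H * phi (edges H).
Proof.
rewrite /pE (reindex_omap (@edges n) insub) /=.
  2: by move=> S; rewrite powersetE => hS; rewrite insubT.
rewrite /gnp_mass; apply: eq_bigl => H; rewrite powersetE edges_pairs.
by rewrite (_ : insub (edges H) = Some H) ?eqxx //; exact: (valK H).
Qed.

Lemma gnp_mass_ge0 (p : R) n (H : graph n) : 0 <= p <= 1 -> 0 <= gnp_mass p H.
Proof.
move=> /andP[p0 p1]; apply: prodr_ge0 => e _.
by case: ifP => // _; rewrite subr_ge0.
Qed.

Lemma sum_gnp_mass (p : R) n : \sum_(H : graph n) gnp_mass p H = 1.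
Proof.
rewrite -(pE_cst p (pairs 'I_n) 1) pE_gnp.
by apply: eq_bigr => H _; rewrite mulr1.
Qed.

Lemma gnp_probC (p : R) n (A : graph n -> Prop) :
  gnp_prob p A = 1 - gnp_prob p (fun H => ~ A H).
Proof.
rewrite -(sum_gnp_mass p n) (bigID (fun H => `[< A H >])) /= /gnp_prob.
rewrite -addrA -[LHS]addr0; congr (_ + _); apply/esym/eqP; rewrite subr_eq0.
by apply/eqP; apply: eq_bigl => H; rewrite asbool_neg.
Qed.

Lemma gnp_probE (p : R) n (A : graph n -> Prop) :
  gnp_prob p A = \sum_(H : graph n) if `[< A H >] then gnp_mass p H else 0.
Proof. exact: big_mkcond. Qed.

Lemma gnp_prob_le (p : R) n (A B : graph n -> Prop) : 0 <= p <= 1 ->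
  (forall H, A H -> B H) -> gnp_prob p A <= gnp_prob p B.
Proof.
move=> p01 AB; rewrite !gnp_probE.
apply: ler_sum => H _; case: asboolP => [/AB h|_]; first by rewrite asboolT.
by case: ifP => // _; exact: gnp_mass_ge0.
Qed.

Lemma gnp_probU (p : R) n (A B : graph n -> Prop) : 0 <= p <= 1 ->
  gnp_prob p (fun H => A H \/ B H) <= gnp_prob p A + gnp_prob p B.
Proof.
move=> p01; rewrite !gnp_probE -big_split /=.
apply: ler_sum => H _; have h0 := gnp_mass_ge0 H p01.
case: asboolP => [[h|h]|_]; rewrite ?(asboolT h).
- by rewrite lerDl; case: ifP.
- by rewrite lerDr; case: ifP.
- by apply: addr_ge0; case: ifP.
Qed.

Lemma gnp_prob_le_pE (p : R) n (A : graph n -> Prop) phi : 0 <= p <= 1 ->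
  (forall H, A H -> 1 <= phi (edges H)) -> (forall S, 0 <= phi S) ->
  gnp_prob p A <= pE p (pairs 'I_n) phi.
Proof.
move=> p01 h1 h0; rewrite pE_gnp gnp_probE.
apply: ler_sum => H _; have hm := gnp_mass_ge0 H p01.
case: asboolP => [/h1 h|_]; last by rewrite mulr_ge0.
by rewrite ler_peMr.
Qed.

Definition aas (p : nat -> R) (A : forall n, graph n -> Prop) : Prop :=
  forall e : R, 0 < e -> \forall n \near \oo%classic, gnp_prob (p n) (fun H => ~ A n H) <= e.

Variable p : nat -> R.
Hypothesis p01 : forall n, 0 <= p n <= 1.

Lemma aas_and A B : aas p A -> aas p B -> aas p (fun n H => A n H /\ B n H).
Proof.
move=> hA hB e e0; have e20 : 0 < e / 2 by rewrite divr_gt0.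
near=> n.
apply: (@le_trans _ _ (gnp_prob (p n) (fun H => ~ A n H \/ ~ B n H))).
  by apply: gnp_prob_le => // H; rewrite not_andP.
apply: le_trans (gnp_probU _ _ (p01 n)) _.
rewrite [leRHS](splitr e) lerD //; near: n; [exact: hA|exact: hB].
Unshelve. all: by end_near. Qed.

Lemma aas_imp A B : (\forall n \near \oo%classic, forall H, A n H -> B n H) ->
  aas p A -> aas p B.
Proof.
move=> hAB hA e e0; near=> n.
apply: le_trans (_ : gnp_prob (p n) (fun H => ~ A n H) <= _).
  by apply: gnp_prob_le => // H hB hA'; apply: hB; exact: (near hAB n).
by near: n; exact: hA.
Unshelve. all: by end_near. Qed.

Lemma aas_forall N (A : nat -> forall n, graph n -> Prop) :
  (forall i, (i < N)%N -> aas p (A i)) ->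
  aas p (fun n H => forall i, (i < N)%N -> A i n H).
Proof.
elim: N => [_|N IH h].
  move=> e e0; near=> n; apply: le_trans (ltW e0).
  by rewrite /gnp_prob big_pred0 // => H; apply/asboolP => h; apply: h.
have {}IH : aas p (fun n H => forall i, (i < N)%N -> A i n H).
  by apply: IH => i iN; apply: h; apply: ltnW.
apply: aas_imp (aas_and IH (h N (ltnSn N))); apply: nearW => n H [h1 h2] i.
by rewrite ltnS leq_eqVlt => /predU1P[->|/h1].
Unshelve. all: by end_near. Qed.

End GnpBasics.

(** * Transversal cycles in the random graph *)

Section TransversalAas.
Import mathcomp.boot.fintype mathcomp.boot.finset.
Local Set Implicit Arguments.
Local Unset Strict Implicit.
Local Unset Printing Implicit Defensive.

(* For [s < l] only a path is required: [j.+1 %% s] wraps around only when the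
   closing edge is asked for. *)
Definition transversal_cycles (l s c n : nat) (H : graph n) : Prop :=
  forall W : nat -> {set 'I_n}, (forall j, (j < s)%N -> (n <= c * #|W j|)%N) ->
  exists t : nat -> 'I_n,
    [/\ forall j, (j < s)%N -> t j \in W j,
        forall i j, (i < s)%N -> (j < s)%N -> t i = t j -> i = j
      & forall j, (j < s)%N -> (j.+1 < s)%N || (l <= s)%N ->
          adj H (t j) (t (j.+1 %% s)%N)].

(** Brings a failure into the setting of [cycle_janson]: the sets may be shrunk to disjoint ones of
    equal size. *)
Lemma not_transversal_disjoint l s c n (H : graph n) : (3 <= s)%N -> (0 < c)%N ->
  ~ transversal_cycles l s c H ->
  exists W : {ffun 'I_s -> {set 'I_n}},
    [/\ forall i j, i != j -> [disjoint W i & W j],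
        forall i, #|W i| = (n %/ (c * s))%N
      & ~~ [exists x : {ffun 'I_s -> 'I_n},
            [forall i, x i \in W i] && (cyc_edges x \subset edges H)]].
Proof.
move=> s3 c0 /existsNP[W /not_implyP[hW hno]].
have [|W' hW'] := @disjoint_sublists _ W s (n %/ (c * s)).
  move=> j js; rewrite -(leq_pmul2l c0) mulnA (leq_trans _ (hW j js)) //.
  by rewrite mulnC leq_trunc_div.
have Wd (i j : 'I_s) : i != j -> [disjoint W' i & W' j].
  move=> ij; have : (i < j)%N || (j < i)%N by rewrite -neq_ltn.
  case/orP => h; first by have [_ _] := hW' j (ltn_ord j); apply.
  by rewrite disjoint_sym; have [_ _] := hW' i (ltn_ord i); apply.
exists [ffun i : 'I_s => W' i]; split.
- by move=> i j; rewrite !ffunE; apply: Wd.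
- by move=> i; rewrite ffunE; have [] := hW' i (ltn_ord i).
apply/negP => /existsP[x /andP[/forallP xW xH]]; apply: hno.
case: s s3 W' hW' Wd x xW xH {hW} => // s s3 W' hW' Wd x xW xH.
exists (fun j => x (inord j)); split.
- move=> j js; have := xW (inord j); rewrite ffunE inordK //.
  by have [/subsetP h _ _] := hW' j js; apply: h.
- move=> i j si sj e; apply/eqP/negPn/negP => ij.
  have := Wd (inord i) (inord j); rewrite -val_eqE /= !inordK // => /(_ ij).
  rewrite disjoints_subset => /subsetP /(_ (x (inord i))).
  have := xW (inord i); have := xW (inord j); rewrite !ffunE !inordK // => h1 h2.
  by move=> /(_ h2); rewrite inE e h1.
- move=> j js _; apply: (subsetP xH).
  rewrite (_ : [set _; _] = cyc_edge x (inord j)) ?imset_f //.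
  rewrite /cyc_edge; congr [set _; x _].
  by apply/val_inj; rewrite /= !inordK // ltn_pmod.
Qed.

Variable R : realType.

(** Having no transversal cycle is a decreasing event, so passing from [p] to [q] only increases its
    probability. The passage is necessary because the overlap condition, the last hypothesis, fails
    for large probabilities. The factor (2^n)^s counts the choices of the sets. *)
Lemma gnp_prob_not_transversal (p q : R) l s c n : (3 <= s)%N -> (0 < c)%N ->
  0 <= q -> q <= p -> p <= 1 ->
  1 <= (n %/ (c * s))%:R * q ->
  2 ^+ s * (((n %/ (c * s))%:R * q) ^+ (s - 2) * q) <= 2^-1 ->
  gnp_prob p (fun H : graph n => ~ transversal_cycles l s c H)
   <= (2 ^+ n) ^+ s * (1 - q ^+ s / 2) ^+ ((n %/ (c * s)) ^ s).
Proof.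
move=> s3 c0 q0 qp p1 h1 h2; set w := (n %/ (c * s))%N in h1 h2 *.
pose okW (W : {ffun 'I_s -> {set 'I_n}}) :=
  [forall i, forall j, (i != j) ==> [disjoint W i & W j]] && [forall i, #|W i| == w].
pose bad (W : {ffun 'I_s -> {set 'I_n}}) (S : {set {set 'I_n}}) : R :=
  (~~ [exists x : {ffun 'I_s -> 'I_n},
            [forall i, x i \in W i] && (cyc_edges x \subset S)])%:R.
apply: le_trans (_ : pE p (pairs 'I_n) (fun S => \sum_(W | okW W) bad W S) <= _).
  apply: gnp_prob_le_pE => [|H /(not_transversal_disjoint s3 c0)|S].
  - by rewrite (le_trans q0 qp).
  - move=> [W [Wd Wc Wx]]; rewrite (bigD1 W) /=.
      by rewrite /bad Wx lerDl; apply: sumr_ge0.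
    apply/andP; split; last by apply/forallP => i; rewrite Wc.
    by apply/forallP => i; apply/forallP => j; apply/implyP/Wd.
  - exact: sumr_ge0.
rewrite pE_sum.
have -> : (2 ^+ n) ^+ s * (1 - q ^+ s / 2) ^+ (w ^ s) =
    \sum_(W : {ffun 'I_s -> {set 'I_n}}) (1 - q ^+ s / 2) ^+ (w ^ s).
  rewrite sumr_const card_ffun card_ord -[#|{set 'I_n}|]cardsT.
  have -> : [set: {set 'I_n}] = powerset [set: 'I_n].
    by apply/setP => A; rewrite !inE subsetT.
  by rewrite card_powerset cardsT card_ord -[RHS]mulr_natl !natrX.
have q1 : q ^+ s <= 1 by rewrite exprn_ile1 // (le_trans qp).
rewrite [leLHS]big_mkcond; apply: ler_sum => W _; case: ifP => [|_]; last first.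
  by rewrite exprn_ge0 //; lra.
case/andP => /forallP Wd /forallP Wc.
apply: le_trans (_ : pE q (pairs 'I_n) (bad W) <= _).
  rewrite -lerN2 -!pEN; apply: le_pE_mono => // S S' sS.
  rewrite lerN2; apply: ler_bool; apply: contra => /existsP[x /andP[xW xS]].
  by apply/existsP; exists x; rewrite xW (subset_trans xS).
apply: cycle_janson => //.
- by move=> i j; have /forallP/(_ j)/implyP := Wd i.
- by move=> i; apply/eqP.
- by rewrite q0 (le_trans qp).
Qed.

(** Here t = n^(1/s), so q = C n^(-1+1/s) and nq = C t. Rounding gives w >= n/(2cs), and C is chosen
    so that wq >= 2(s+1)t; then (wq)^s / 2 >= (s+1) n, which beats 2^(sn) <= exp(sn) and leaves
    exp(-n). The overlap condition amounts to 2^s C^(s-1) / t <= 1/2, the lower bound assumed for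
    t. *)
Lemma not_transversal_bound (s c n : nat) (t : R) : (3 <= s)%N -> (0 < c)%N ->
  t ^+ s = n%:R -> (2 * (c * s) <= n)%N ->
  let C : R := (4 * (c * s) * s.+1)%:R in
  2 ^+ s.+1 * C ^+ s.-1 <= t ->
  let q := C / t ^+ s.-1 in let w : R := (n %/ (c * s))%:R in
  [/\ 1 <= w * q, 2 ^+ s * ((w * q) ^+ (s - 2) * q) <= 2^-1
    & q <= 1 -> (2 ^+ n) ^+ s * (1 - q ^+ s / 2) ^+ ((n %/ (c * s)) ^ s) <= expR (- n%:R)].
Proof.
move=> s3 c0 ts hn C ht q w.
have cs0 : (0 < c * s)%N by rewrite muln_gt0 c0 (leq_trans _ s3).
have C1 : 1 <= C by rewrite ler1n; nia.
have t1 : 1 <= t.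
  apply: le_trans ht; rewrite mulr_ege1 //; first by rewrite exprn_ege1 // ler1n.
  by rewrite exprn_ege1.
have t0 : 0 < t by lra.
have tE : t ^+ s = t * t ^+ s.-1 by rewrite -exprS prednK // (leq_trans _ s3).
have u0 : 0 < t ^+ s.-1 by rewrite exprn_gt0.
have q0 : 0 <= q by rewrite divr_ge0 // ?ltW //; lra.
have nE : n%:R * q = C * t by rewrite -ts tE /q; field; rewrite gt_eqF.
have w_le : w <= n%:R by rewrite ler_nat leq_div.
have w_ge : n%:R <= (2 * (c * s))%:R * w.
  rewrite -natrM ler_nat {1}(divn_eq n (c * s)).
  have h1 : (n %% (c * s) < c * s)%N by rewrite ltn_mod.
  have h2 : (0 < n %/ (c * s))%N by rewrite divn_gt0 //; lia.
  by nia.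
have wq_ge : 2 * s.+1%:R * t <= w * q.
  have d0 : 0 < (2 * (c * s))%:R :> R by rewrite ltr0n muln_gt0.
  rewrite -(ler_pM2l d0) (@le_trans _ _ (n%:R * q)) //; last first.
    by rewrite [leRHS]mulrA ler_wpM2r.
  rewrite nE /C mulrA ler_pM2r // -!natrM ler_nat; nia.
have wq1 : 1 <= w * q.
  by apply: le_trans wq_ge; rewrite mulr_ege1 // -natrM ler1n.
have wq_le : w * q <= C * t by rewrite -nE ler_wpM2r.
split => //.
  apply: (@le_trans _ _ (2 ^+ s * ((C * t) ^+ (s - 2) * q))).
    by rewrite ler_wpM2l ?exprn_ge0 // ler_wpM2r // lerXn2r // nnegrE; lra.
  have e : (s.-1 = (s - 2).+1)%N by lia.
  have -> : 2 ^+ s * ((C * t) ^+ (s - 2) * q) = (2 ^+ s.+1 * C ^+ s.-1) / t / 2.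
    rewrite /q exprMn e !exprS; field.
    by rewrite gt_eqF // expf_neq0 // gt_eqF.
  by rewrite -[leRHS]mul1r ler_wpM2r ?invr_ge0 // ler_pdivrMr // mul1r.
move=> q1; have qs0 : 0 <= q ^+ s by rewrite exprn_ge0.
have qs1 : q ^+ s <= 1 by rewrite exprn_ile1.
have s1 : (2 * s.+1%:R * t) ^+ s <= (w * q) ^+ s.
  rewrite lerXn2r // nnegrE; [|lra].
  by rewrite mulr_ge0 // ?mulr_ge0 // ltW.
have hexp : (1 - q ^+ s / 2) ^+ ((n %/ (c * s)) ^ s) <= expR (- (s.+1%:R * n%:R)).
  apply: le_trans (_ : expR (- (q ^+ s / 2)) ^+ ((n %/ (c * s)) ^ s) <= _).
    rewrite lerXn2r // ?nnegrE; [lra|exact: expR_ge0|exact: expR_ge1Dx].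
  rewrite -expRM_natl ler_expR mulrN lerN2 natrX -/w.
  rewrite (_ : w ^+ s * (q ^+ s / 2) = (w * q) ^+ s / 2); last by rewrite [(w * q) ^+ s]exprMn mulrA.
  rewrite ler_pdivlMr // (le_trans _ s1) // exprMn ts.
  rewrite mulrAC ler_wpM2r // -natrM -natrX -natrM ler_nat.
  case: s s3 {qs0 qs1 s1 wq_ge tE u0 ts C C1 ht q w q0 nE w_le w_ge wq1 wq_le q1 hn cs0} => // s _.
  by rewrite expnS mulnC leq_pmulr // expn_gt0.
apply: (@le_trans _ _ (expR (s%:R * n%:R) * expR (- (s.+1%:R * n%:R)))).
  apply: ler_pM => //; rewrite ?exprn_ge0 //; first lra.
  rewrite -exprM -[X in expR X]mulr1 -natrM expRM_natl mulnC lerXn2r // ?nnegrE ?expR_ge0 //.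
  by have := expR_ge1Dx (1 : R); lra.
by rewrite -expRD ler_expR -natr1; lra.
Qed.

Lemma root_exists (s n : nat) : (0 < s)%N ->
  exists2 t : R, 0 <= t & t ^+ s = n%:R.
Proof.
move=> s0; exists (n%:R `^ (s%:R^-1)); first exact: powR_ge0.
rewrite -powR_mulrn ?powR_ge0 // -powRrM mulVf ?powRr1 //.
by rewrite pnatr_eq0 -lt0n.
Qed.

Variable p : nat -> R.
Hypothesis p01 : forall n, 0 <= p n <= 1.
Variable l : nat.
Hypothesis l3 : (3 <= l)%N.
Hypothesis p_omega : forall C : R,
  \forall n \near \oo%classic, C <= p n * n%:R `^ ((l%:R - 1) / l%:R).

(** The exponent (s-1)/s increases with s, so the hypothesis on [p], made for [l], also covers the
    longer cycles. *)
Lemma aas_transversal_ge s c : (l <= s)%N -> (0 < c)%N ->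
  aas p (fun n H => transversal_cycles l s c H).
Proof.
move=> ls c0 e e0; have s3 := leq_trans l3 ls.
have s0 : (0 < s)%N by rewrite (leq_trans _ s3).
set C : R := (4 * (c * s) * s.+1)%:R.
near=> n.
have [t t0 ts] := root_exists n s0.
have hn : (2 * (c * s) <= n)%N by near: n; exact: nbhs_infty_ge.
have hn1 : (1 <= n)%N by near: n; exact: nbhs_infty_ge.
have ht : 2 ^+ s.+1 * C ^+ s.-1 <= t.
  have K0 : 0 <= 2 ^+ s.+1 * C ^+ s.-1 by rewrite mulr_ge0 ?exprn_ge0.
  rewrite -(ler_pXn2r s0) ?nnegrE // ts.
  by near: n; exact: nbhs_infty_ger.
have [h1 h2 h3] := not_transversal_bound s3 c0 ts hn ht.
have tp : 0 < t.
  rewrite lt_neqAle t0 andbT; apply/eqP => t00.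
  by move: ts; rewrite -t00 expr0n gtn_eqF // => /eqP; rewrite eq_sym pnatr_eq0 gtn_eqF.
have u0 : 0 < t ^+ s.-1 by rewrite exprn_gt0.
have qp : C / t ^+ s.-1 <= p n.
  rewrite ler_pdivrMr //.
  apply: (@le_trans _ _ (p n * n%:R `^ ((l%:R - 1) / l%:R))).
    by near: n; exact: p_omega.
  have [p0 _] := andP (p01 n); rewrite ler_wpM2l //.
  have -> : t ^+ s.-1 = n%:R `^ ((s%:R - 1) / s%:R).
    rewrite -ts -!powR_mulrn // -powRrM; congr (_ `^ _).
    rewrite mulrC divfK ?pnatr_eq0 -?lt0n //.
    by rewrite -{2}(prednK s0) -natr1 addrK.
  apply: ler_powR; first by rewrite ler1n.
  have lp : 0 < l%:R :> R by rewrite ltr0n (leq_trans _ l3).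
  have sp : 0 < s%:R :> R by rewrite ltr0n.
  rewrite !mulrBl !divff ?gt_eqF // lerD2l lerN2 !mul1r lef_pV2 ?posrE //.
  by rewrite ler_nat.
have [p0 p1] := andP (p01 n).
have C0 : 0 <= C by rewrite ler0n.
apply: le_trans (gnp_prob_not_transversal l s3 c0 _ qp p1 h1 h2) _.
  by rewrite divr_ge0 // ltW.
apply: le_trans (h3 (le_trans qp p1)) _.
rewrite expRN -[leRHS]invrK lef_pV2 ?posrE ?expR_gt0 ?invr_gt0 //.
apply: le_trans (expR_ge1Dx _).
have : e^-1 <= n%:R by near: n; exact: nbhs_infty_ger.
by lra.
Unshelve. all: by end_near. Qed.

(** Below [l] only a path is asked for, and it is cut out of a transversal [l]-cycle. *)
Lemma aas_transversal s c : (0 < s)%N -> (0 < c)%N ->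
  aas p (fun n H => transversal_cycles l s c H).
Proof.
move=> s0 c0; case: (leqP l s) => [|sl]; first by move/aas_transversal_ge; apply.
apply: aas_imp (aas_transversal_ge (leqnn l) c0) => //; apply: nearW => n H hH W hW.
(* The positions from [s] on are fillers, for which any large set will do. *)
have [|t [t1 t2 t3]] := hH (fun j => if (j < s)%N then W j else W 0%N).
  by move=> j _; case: ifP => [|_]; apply: hW.
exists t; split.
- by move=> j js; have := t1 j (ltn_trans js sl); rewrite js.
- by move=> i j si sj; apply: t2; [apply: ltn_trans si sl|apply: ltn_trans sj sl].
- move=> j js; rewrite [(l <= s)%N]leqNgt sl orbF => js1.
  have := t3 j (ltn_trans js sl); rewrite (ltn_trans js1 sl) => /(_ isT).
  by rewrite !modn_small // (ltn_trans js1).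
Qed.

End TransversalAas.

(** * Random permutations *)

Section RandomPermutation.
Import mathcomp.boot.fintype mathcomp.boot.finset.
Local Set Implicit Arguments.
Local Unset Strict Implicit.
Local Unset Printing Implicit Defensive.
Local Open Scope nat_scope.
Variable V : finType.
Implicit Types (Q : {set {perm V}}) (I B C : {set V}).

(* Conditioning a uniform permutation on some of its values gives a uniform
   distribution on such a set [Q], with [I] the prescribed values. *)
Definition stable_off I Q := forall s t : {perm V}, s \in Q ->
  (forall i, i \in I -> t i = i) -> (s * t)%g \in Q.

Definition cond_perm Q x y := [set s : {perm V} in Q | s x == y].

Lemma stable_cond_perm I Q x y :
  stable_off I Q -> stable_off (y |: I) (cond_perm Q x y).
Proof.
move=> hQ s t; rewrite inE => /andP[sQ /eqP sx] ht.
rewrite inE hQ //=; first by rewrite permM sx ht ?setU11.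
by move=> i iI; apply: ht; rewrite inE iI orbT.
Qed.

(** Composing with the transposition of two values outside [I] turns permutations with [s x = y1]
    injectively into permutations with [s x = y2], so all values outside [I] are equally
    frequent. *)
Lemma card_cond_perm I Q x y : stable_off I Q ->
  (forall s, s \in Q -> s x \notin I) -> y \notin I ->
  (#|V| - #|I|) * #|cond_perm Q x y| = #|Q|.
Proof.
move=> hQ hx yI.
have le_cond y1 y2 : y1 \notin I -> y2 \notin I ->
    #|cond_perm Q x y1| <= #|cond_perm Q x y2|.
  move=> h1 h2; have inj : injective (fun s : {perm V} => (s * tperm y1 y2)%g).
    by move=> s s' /mulIg.
  rewrite -(card_imset _ inj); apply/subset_leq_card/subsetP => _ /imsetP[s + ->].
  rewrite inE => /andP[sQ /eqP sx]; rewrite inE permM sx tpermL eqxx andbT.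
  apply: hQ => // i iI; rewrite tpermD //.
    by apply: contraNneq h1 => ->.
  by apply: contraNneq h2 => ->.
have -> : #|Q| = \sum_(z in ~: I) #|cond_perm Q x z|.
  rewrite -sum1_card (partition_big (fun s : {perm V} => s x) (mem (~: I))) /=.
    by apply: eq_bigr => z _; rewrite -sum1_card; apply: eq_bigl => s; rewrite inE.
  by move=> s /hx; rewrite inE.
rewrite (eq_bigr (fun=> #|cond_perm Q x y|)) => [|z].
  by rewrite sum_nat_const -(cardsC I) addKn.
by rewrite inE => zI; apply/eqP; rewrite eqn_leq !le_cond.
Qed.

(** [I] takes at most half of the share |V|/a guaranteed to [B], so the new value [s x] falls into
    [B :\: I] with probability at least 1/(2a). [K] carries the loss from values revealed later. *)
Lemma card_cond_step a K I Q x B (P : pred {perm V}) : stable_off I Q ->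
  (forall s, s \in Q -> s x \notin I) ->
  #|V| <= a * #|B| -> 2 * a * #|I| <= #|V| ->
  (forall y, y \in B -> y \notin I ->
     #|cond_perm Q x y| <= K * #|[set s in cond_perm Q x y | P s]|) ->
  #|Q| <= 2 * a * K * #|[set s : {perm V} in Q | (s x \in B) && P s]|.
Proof.
move=> hQ hx hB hI hK; set X := #|[set s in Q | _]|.
have V0 : 0 < #|V| by apply/card_gt0P; exists x.
have hX : \sum_(y in B :\: I) #|[set s in cond_perm Q x y | P s]| <= X.
  rewrite /X -sum1_card (partition_big (fun s : {perm V} => s x) predT) //=.
  rewrite big_mkcond; apply: leq_sum => y _; case: ifP => // yBI.
  rewrite -sum1_card; rewrite [leqLHS]big_mkcond [leqRHS]big_mkcond.
  apply: leq_sum => s _; rewrite !inE; move: yBI; rewrite inE => /andP[_ yB].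
  by case: eqP => [->|]; rewrite ?andbF // yB andbT /= andbC; case: ifP.
have hS : #|Q| * #|B :\: I| <= #|V| * (K * X).
  rewrite mulnC -sum_nat_const.
  apply: leq_trans (_ : \sum_(y in B :\: I) #|V| * (K * #|[set s in cond_perm Q x y | P s]|) <= _).
    apply: leq_sum => y; rewrite inE => /andP[yI yB].
    rewrite -(card_cond_perm hQ hx yI).
    by rewrite leq_mul ?leq_subr ?hK.
  by rewrite -big_distrr -big_distrr /= leq_mul // leq_mul.
have hBI : #|V| <= 2 * a * #|B :\: I|.
  have := cardsID I B; have := subset_leq_card (subsetIr B I); nia.
rewrite -(leq_pmul2l V0); apply: leq_trans (_ : 2 * a * (#|Q| * #|B :\: I|) <= _).
  by rewrite mulnC (leq_trans (leq_mul (leqnn #|Q|) hBI)) //; lia.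
by apply: leq_trans (leq_mul (leqnn (2 * a)) hS) _; lia.
Qed.

Lemma card_good_triple a I Q x y z B C : stable_off I Q ->
  uniq [:: x; y; z] ->
  (forall s u, s \in Q -> u \in [:: x; y; z] -> s u \notin I) ->
  #|V| <= a * #|B| -> #|V| <= a * #|C| -> 2 * a * (#|I| + 3) <= #|V| ->
  #|Q| <= 8 * a ^ 3 * #|[set s : {perm V} in Q | [&& s x \in B, s y \in C & s z \in B]]|.
Proof.
move=> hQ /=; rewrite !inE !negb_or => /and3P[/andP[xy xz] yz _] hI hB hC hn.
have card1 (J : {set V}) (b : V) : #|b |: J| <= #|J|.+1.
  by rewrite cardsU1; case: (b \notin J).
have -> : 8 * a ^ 3 = 2 * a * (2 * a * (2 * a * 1)) by ring.
have hm m : m <= #|I| + 3 -> 2 * a * m <= #|V|.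
  by move=> h; apply: leq_trans hn; rewrite leq_mul2l h orbT.
apply: (card_cond_step (x := x) hQ) => //; [|by apply: hm; rewrite leq_addr|].
  by move=> s sQ; apply: hI => //; rewrite inE eqxx.
move=> b bB bI.
set Q1 := cond_perm Q x b; set I1 := b |: I.
have hQ1 : stable_off I1 Q1 by exact: stable_cond_perm.
have cI1 : #|I1| <= #|I|.+1 by exact: card1.
have hI1 u s : u != x -> u \in [:: x; y; z] -> s \in Q1 -> s u \notin I1.
  move=> ux hu; rewrite inE => /andP[sQ /eqP sx]; rewrite !inE negb_or hI // andbT.
  by rewrite -sx (inj_eq perm_inj).
apply: (card_cond_step (x := y) hQ1) => //; [|by apply: hm; lia|].
  by move=> s; apply: hI1; rewrite 1?eq_sym // !inE eqxx orbT.
move=> c cC cI.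
set Q2 := cond_perm Q1 y c; set I2 := c |: I1.
have hQ2 : stable_off I2 Q2 by exact: stable_cond_perm.
have cI2 : #|I2| <= #|I|.+2 by apply: leq_trans (card1 _ _) _.
have -> : [set s in Q2 | s z \in B] = [set s in Q2 | (s z \in B) && true].
  by apply/setP => s; rewrite !inE andbT.
apply: (card_cond_step (x := z) hQ2) => //; [|by apply: hm; lia|].
  move=> s; rewrite inE => /andP[sQ /eqP sy]; rewrite inE negb_or; apply/andP; split.
    by rewrite inE -sy (inj_eq perm_inj) eq_sym.
  by apply: hI1 => //; rewrite ?inE ?eqxx ?orbT // eq_sym.
move=> d _ _; rewrite mul1n; apply/subset_leq_card/subsetP => s h.
by rewrite inE h.
Qed.

Definition triple_points (T : seq (V * V * V)) : seq V :=
  flatten [seq [:: t.1.1; t.1.2; t.2] | t <- T].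

Definition good_triple B C (t : V * V * V) :=
  [&& t.1.1 \in B, t.1.2 \in C & t.2 \in B].

Definition perm_triple (s : {perm V}) (t : V * V * V) := (s t.1.1, s t.1.2, s t.2).

(** An exponential moment: the mean of 2^(-N) for the number N of good triples. The triples are
    revealed one at a time; each is good with conditional probability at least 1/(8 a^3), and a good
    one halves the weight, hence the factor 1 - 1/(16 a^3). Revealed values are collected in [I],
    which the last hypothesis keeps small throughout. *)
Lemma sum_good_triples (R : realType) a I Q B C (T : seq (V * V * V)) :
  stable_off I Q -> uniq (triple_points T) ->
  (forall s u, s \in Q -> u \in triple_points T -> s u \notin I) ->
  #|V| <= a * #|B| -> #|V| <= a * #|C| -> 2 * a * (#|I| + 3 * size T) <= #|V| ->
  (\sum_(s in Q) \prod_(t <- T) (if good_triple B C (perm_triple s t) then 2^-1 else 1)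
    <= (1 - (16 * a ^ 3)%:R^-1) ^+ size T * #|Q|%:R :> R)%R.
Proof.
move=> + + + hB hC; elim: T I Q => [|t T IH] I Q hQ.
  by move=> _ _ _; rewrite mul1r (eq_bigr (fun=> 1%R)) ?sumr_const // => s _; rewrite big_nil.
case: t => [[x y] z]; rewrite /triple_points /= -/(triple_points T).
move=> /and4P[hx hy hz hT] hI hn.
have V0 : 0 < #|V| by apply/card_gt0P; exists x.
have a0 : 0 < a by case: (a) hB => //; rewrite mul0n leqNgt V0.
set rho : R := (1 - _)%R.
have rho0 : (0 <= rho)%R.
  rewrite subr_ge0 invf_le1 ?ltr0n ?ler1n; nia.
pose w (u : V * V * V) : R := (if good_triple B C u then 2^-1 else 1)%R.
have w0 u : (0 <= w u)%R by rewrite /w; case: ifP => _; rewrite ?invr_ge0.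
pose img (s : {perm V}) := perm_triple s (x, y, z).
apply: (@le_trans _ _ (rho ^+ size T * \sum_(s in Q) w (img s))%R).
  rewrite mulr_sumr (partition_big img predT) // [leRHS](partition_big img predT) //=.
  apply: ler_sum => -[[x' y'] z'] _.
  (* On [Q'] the image of the first triple is fixed, so its weight factors out and the induction
     hypothesis applies with three more prescribed values. *)
  set Q' := cond_perm (cond_perm (cond_perm Q x x') y y') z z'.
  have Q'E s : ((s \in Q) && (img s == (x', y', z'))) = (s \in Q').
    by rewrite /Q' !inE /img /perm_triple /= !xpair_eqE !andbA.
  rewrite (eq_bigl _ _ Q'E) [leRHS](eq_bigl _ _ Q'E).
  have imgE s : s \in Q' -> img s = (x', y', z') by rewrite -Q'E => /andP[_ /eqP].
  have hQ' : stable_off (z' |: (y' |: (x' |: I))) Q' by do 3!apply: stable_cond_perm.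
  have hIH := IH _ _ hQ' hT.
  have {}hIH : (\sum_(s in Q') \prod_(t <- T)
      (if good_triple B C (perm_triple s t) then 2^-1 else 1) <= rho ^+ size T * #|Q'|%:R)%R.
    apply: hIH.
      move=> s u; rewrite -Q'E => /andP[sQ /eqP[<- <- <-]] uT.
      rewrite !inE !negb_or !(inj_eq perm_inj) hI ?inE ?uT ?orbT // andbT.
      apply/and3P; split; apply: contraTneq uT => ->; move: hx hy hz; rewrite !inE !negb_or.
      - by [].
      - by move=> _ /andP[].
      - by move=> /and3P[].
    have card1 (J : {set V}) (b : V) : #|b |: J| <= #|J|.+1.
      by rewrite cardsU1; case: (b \notin J).
    apply: leq_trans hn; rewrite leq_mul2l; apply/orP; right.
    have := card1 (y' |: (x' |: I)) z'; have := card1 (x' |: I) y'; have := card1 I x'.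
    by rewrite /=; lia.
  rewrite (eq_bigr (fun s => w (x', y', z') * \prod_(t <- T)
     (if good_triple B C (perm_triple s t) then 2^-1 else 1))%R); last first.
    by move=> s /imgE <-; rewrite big_cons.
  rewrite [leRHS](eq_bigr (fun=> rho ^+ size T * w (x', y', z')))%R; last first.
    by move=> s /imgE ->.
  rewrite -mulr_sumr sumr_const -[leRHS]mulr_natl [leRHS]mulrA [leRHS]mulrC ler_wpM2l //.
  by rewrite mulrC.
rewrite exprS [leRHS]mulrAC [leRHS]mulrC ler_wpM2l ?exprn_ge0 //.
have hg := @card_good_triple a I Q x y z B C hQ _ _ hB hC _.
set Y := [set s in Q | good_triple B C (img s)].
have -> : (\sum_(s in Q) w (img s) = #|Q|%:R - 2^-1 * #|Y|%:R)%R.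
  rewrite (eq_bigr (fun s => 1 - 2^-1 * (good_triple B C (img s))%:R)%R); last first.
    by move=> s _; rewrite /w; case: ifP => _; rewrite ?mulr0 ?mulr1; lra.
  rewrite sumrB sumr_const -mulr_sumr -natr_sum; congr (_ - _ * _%:R)%R.
  rewrite -sum1_card big_mkcond [RHS]big_mkcond; apply: eq_bigr => s _.
  by rewrite inE; case: (s \in Q) => //=; case: good_triple.
have {}hg : #|Q| <= 8 * a ^ 3 * #|Y|.
  apply: hg.
  - move: hx hy; rewrite /= !inE !negb_or => /and3P[-> -> _] /andP[-> _].
    by [].
  - move=> s u sQ hu; apply: hI => //; move: hu; rewrite !inE.
    by case/or3P => ->; rewrite ?orbT.
  - by apply: leq_trans hn; rewrite leq_mul2l leq_add2l /=; lia.
have a30 : (0 < (8 * a ^ 3)%:R :> R)%R by rewrite ltr0n muln_gt0 expn_gt0 a0.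
rewrite /rho (_ : 16 * a ^ 3 = 2 * (8 * a ^ 3)); last lia.
rewrite [(2 * _)%N%:R]natrM invfM mulrBl mul1r lerD2l lerN2 -mulrA ler_wpM2l ?invr_ge0 //.
by rewrite mulrC ler_pdivrMr // mulrC -natrM ler_nat.
Qed.

End RandomPermutation.

(** * Gadgets *)

Section Gadgets.
Import mathcomp.boot.fintype mathcomp.boot.finset.
Local Set Implicit Arguments.
Local Unset Strict Implicit.
Local Unset Printing Implicit Defensive.
Variable R : realType.

Definition nbr n (G : graph n) v : {set 'I_n} := [set u | adj G v u].

Lemma prod_if_half (T : Type) (P : pred T) (r : seq T) :
  \prod_(t <- r) (if P t then 2^-1 else 1 : R) = 2^-1 ^+ count P r.
Proof.
elim: r => [|t r IH]; first by rewrite big_nil.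
by rewrite big_cons IH /=; case: (P t); rewrite ?mul1r // exprS.
Qed.

Lemma leq_card_bigcup (I T : finType) (F : I -> {set T}) :
  (#|\bigcup_i F i| <= \sum_i #|F i|)%N.
Proof.
apply: (big_ind2 (fun (A : {set T}) k => #|A| <= k)%N) => [|A k B k' hA hB|//].
  by rewrite cards0.
by rewrite (leq_trans (leq_card_setU _ _)) // leq_add.
Qed.

(** Markov's inequality for 2^(-N), which is at least 2^(-h) when at most [h] triples are good. *)
Lemma few_good_triples n (G : graph n) a h (T : seq ('I_n * 'I_n * 'I_n)) v z :
  (forall v, (n <= a * #|nbr G v|)%N) -> uniq (triple_points T) ->
  (2 * a * (3 * size T) <= n)%N ->
  #|[set s : {perm 'I_n} |
      (count (fun t => good_triple (nbr G v) (nbr G z) (perm_triple s t)) T <= h)%N]|%:R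
  <= 2 ^+ h * (1 - (16 * a ^ 3)%:R^-1) ^+ size T * #|{perm 'I_n}|%:R :> R.
Proof.
move=> hG uT hn; 
pose c (s : {perm 'I_n}) :=
  count (fun t => good_triple (nbr G v) (nbr G z) (perm_triple s t)) T.
set X := [set s | _].
have h2 : 0 < 2 ^+ h :> R by rewrite exprn_gt0.
rewrite -mulrA mulrC -ler_pdivrMr //.
have := @sum_good_triples _ R a set0 [set: {perm 'I_n}] (nbr G v) (nbr G z) T.
rewrite cards0 add0n card_ord cardsT => h0.
apply: le_trans (h0 _ uT _ (hG v) (hG z) hn).
- rewrite (eq_bigr (fun s => 2^-1 ^+ c s)) => [|s _]; last first.
    by rewrite (prod_if_half (fun t => good_triple (nbr G v) (nbr G z) (perm_triple s t))).
  rewrite -sum1_card natr_sum mulr_suml big_mkcond [leRHS]big_mkcond.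
  apply: ler_sum => s _; rewrite !inE; case: ifP => hs; last by rewrite exprn_ge0 ?invr_ge0.
  by rewrite mul1r -exprVn ler_wiXn2l ?invr_ge0 ?invf_le1 ?ler1n.
- by move=> s t _ _; rewrite inE.
- by move=> s u _ _; rewrite inE.
Qed.

Lemma disjoint_cycles l k m n (H : graph n) : (0 < k)%N -> (l <= k)%N ->
  (2 * k * m <= n)%N -> transversal_cycles l k 2 H ->
  exists x : nat -> nat -> 'I_n,
    (forall i j i' j', (i < m)%N -> (j < k)%N -> (i' < m)%N -> (j' < k)%N ->
        x i j = x i' j' -> i = i' /\ j = j') /\
    (forall i j, (i < m)%N -> (j < k)%N -> adj H (x i j) (x i (j.+1 %% k)%N)).
Proof.
move=> k0 lk + hT; elim: m => [|m IH] hn.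
  (* [x] is a total function, so a vertex is needed even for [m = 0]. With [n = 0], [hT] is
     contradictory since it returns a vertex. *)
  case: n H hT hn => [|n] H hT hn; last by exists (fun _ _ => ord0).
  by have [j _|t _] := hT (fun=> set0); [rewrite leq0n|case: (t 0%N)].
have [|x [xinj xcyc]] := IH; first by nia.
pose U := \bigcup_(i < m) \bigcup_(j < k) [set x i j].
have cU : (#|U| <= k * m)%N.
  have c1 (i : nat) : (#|\bigcup_(j < k) [set x i j]| <= k)%N.
    elim: {k0 lk hT hn xinj xcyc U IH}k => [|k IHk]; first by rewrite big_ord0 cards0.
    rewrite big_ord_recr /= (leq_trans (leq_card_setU _ _)) // cards1 addn1 ltnS.
    exact: IHk.
  rewrite /U; elim: {hn xinj xcyc U IH}m => [|m IHm]; first by rewrite big_ord0 cards0.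
  rewrite big_ord_recr /= (leq_trans (leq_card_setU _ _)) // mulnS addnC.
  by apply: leq_add.
have xU i j : (i < m)%N -> (j < k)%N -> x i j \in U.
  move=> im jk; apply/bigcupP; exists (Ordinal im) => //.
  by apply/bigcupP; exists (Ordinal jk) => //; rewrite inE.
have [|t [t1 t2 t3]] := hT (fun=> ~: U).
  have cUC : (#|~: U| = n - #|U|)%N by rewrite -[X in (X - _)%N]card_ord -(cardsC U) addKn.
  have hkm : (2 * (k * m) <= n)%N by nia.
  move=> j _; rewrite cUC; move: cU hkm; move: #|pred_of_set U| (k * m)%N => u km; lia.
exists (fun i j => if (i < m)%N then x i j else t j); split.
  move=> i j i' j'; rewrite !ltnS => im jk im' jk'.
  case: ltnP => h; case: ltnP => h' e.
  - exact: xinj.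
  - by have := t1 j' jk'; rewrite inE -e xU.
  - by have := t1 j jk; rewrite inE e xU.
  - split; last exact: t2.
    by apply/eqP; rewrite eqn_leq (leq_trans im h') (leq_trans im' h).
move=> i j im jk; case: ltnP => h; first exact: xcyc.
by apply: t3; rewrite ?lk ?orbT.
Qed.

(* The centre [x i (4 b + 1)] of a gadget can be exchanged with any common
   G-neighbour of its two neighbours on the H-cycle [x i]. *)
Definition gadget_centers n (G : graph n) k m (x : nat -> nat -> 'I_n) v z : {set 'I_n} :=
  [set y | [exists i : 'I_m, [exists b : 'I_(k.+1 %/ 4),
    [&& y == x i (4 * b + 1)%N, adj G v (x i (4 * b)%N),
        adj G v (x i (4 * b + 2)%N) & adj G z y]]]].

Definition gadgets k m e n (G H : graph n) : Prop :=
  exists x : nat -> nat -> 'I_n,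
    [/\ forall i j i' j', (i < m)%N -> (j < k)%N -> (i' < m)%N -> (j' < k)%N ->
          x i j = x i' j' -> i = i' /\ j = j',
        forall i j, (i < m)%N -> (j < k)%N -> adj H (x i j) (x i (j.+1 %% k)%N)
      & forall v z, (n <= e * #|gadget_centers G k m x v z|)%N].

Lemma perm_edges_sub n (s : {perm 'I_n}) (H : graph n) :
  (fun e : {set 'I_n} => s @: e) @: edges H \subset pairs 'I_n.
Proof.
apply/subsetP => _ /imsetP[e eH ->]; rewrite inE card_imset; last exact: perm_inj.
by have := subsetP (edges_pairs H) e eH; rewrite inE.
Qed.

Definition perm_graph n (s : {perm 'I_n}) (H : graph n) := Graph (perm_edges_sub s H).

Lemma adj_perm_graph n (s : {perm 'I_n}) (H : graph n) u v :
  adj (perm_graph s H) (s u) (s v) = adj H u v.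
Proof.
rewrite /adj /=; have -> : [set s u; s v] = s @: [set u; v].
  by rewrite imsetU1 imset_set1.
by rewrite mem_imset //; apply: imset_inj; exact: perm_inj.
Qed.

Lemma perm_graph_inj n (s : {perm 'I_n}) : injective (perm_graph s).
Proof.
move=> H H' /(congr1 (@edges n)) /= /imset_inj e; apply/val_inj; apply: e.
by apply: imset_inj; exact: perm_inj.
Qed.

Lemma gnp_mass_perm_graph (p : R) n (s : {perm 'I_n}) (H : graph n) :
  gnp_mass p (perm_graph s H) = gnp_mass p H.
Proof.
have sinj : injective (fun e : {set 'I_n} => s @: e).
  by apply: imset_inj; exact: perm_inj.
rewrite /gnp_mass (reindex_inj sinj) /=; apply: eq_big => e.
  by rewrite !inE card_imset //; exact: perm_inj.
by rewrite mem_imset.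
Qed.

(** [H] may be drawn first and then relabelled uniformly. With [H] and its cycles fixed, the
    permutation is the only randomness left. *)
Lemma gnp_prob_perm_graph (p : R) n (A : graph n -> Prop) :
  gnp_prob p A = \sum_(H : graph n) gnp_mass p H *
    (#|[set s : {perm 'I_n} | `[< A (perm_graph s H) >]]|%:R / #|{perm 'I_n}|%:R).
Proof.
have N0 : #|{perm 'I_n}|%:R != 0 :> R.
  by rewrite pnatr_eq0 -lt0n; apply/card_gt0P; exists 1%g.
have e (s : {perm 'I_n}) : gnp_prob p A =
    \sum_(H : graph n) gnp_mass p H * (`[< A (perm_graph s H) >])%:R.
  rewrite gnp_probE (reindex_inj (@perm_graph_inj n s)) /=; apply: eq_bigr => H _.
  by rewrite gnp_mass_perm_graph; case: asboolP; rewrite ?mulr1 ?mulr0.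
apply: (mulIf N0); rewrite [RHS]mulr_suml.
have -> : gnp_prob p A * #|{perm 'I_n}|%:R = \sum_(s : {perm 'I_n}) gnp_prob p A.
  by rewrite sumr_const mulr_natr; congr (_ *+ _).
rewrite (eq_bigr _ (fun s _ => e s)) exchange_big /=; apply: eq_bigr => H _.
rewrite -mulrA divfK // -mulr_sumr -natr_sum; congr (_ * _%:R).
by rewrite -sum1_card [RHS]big_mkcond; apply: eq_bigr => s _; rewrite inE; case: asboolP.
Qed.

(** The graphs [H] lacking transversal cycles are charged in full to the first term. For the others
    the disjoint cycles are chosen before relabelling, so the triples on them are fixed, and the
    second term is the union bound over the n^2 pairs v, z. *)
Lemma gnp_prob_not_gadgets (p : R) n (G : graph n) a l k m e : 0 <= p <= 1 ->
  (0 < k)%N -> (l <= k)%N -> (0 < e)%N ->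
  (2 * k * m <= n)%N -> (2 * a * (3 * (m * (k.+1 %/ 4))) <= n)%N ->
  (forall v, (n <= a * #|nbr G v|)%N) ->
  gnp_prob p (fun H : graph n => ~ gadgets k m e G H)
   <= gnp_prob p (fun H : graph n => ~ transversal_cycles l k 2 H)
      + (n ^ 2)%:R * (2 ^+ (n %/ e) * (1 - (16 * a ^ 3)%:R^-1) ^+ (m * (k.+1 %/ 4))).
Proof.
move=> p01 k0 lk e0 hkm ham hG; set err := (n ^ 2)%:R * _.
have N0 : 0 < #|{perm 'I_n}|%:R :> R.
  by rewrite ltr0n; apply/card_gt0P; exists 1%g.
rewrite gnp_prob_perm_graph gnp_probE.
have -> : err = \sum_(H : graph n) gnp_mass p H * err.
  by rewrite -mulr_suml sum_gnp_mass mul1r.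
rewrite -big_split /=; apply: ler_sum => H _; have hm := gnp_mass_ge0 H p01.
set X := [set s : {perm 'I_n} | _].
have XN : #|X|%:R / #|{perm 'I_n}|%:R <= 1 :> R.
  by rewrite ler_pdivrMr // mul1r ler_nat max_card.
have err0 : 0 <= err.
  rewrite !mulr_ge0 // exprn_ge0 // subr_ge0.
  case: (posnP a) => [->|a0]; first by rewrite exp0n // muln0 invr0.
  by rewrite invf_le1 ?ler1n ?ltr0n muln_gt0 expn_gt0 a0.
case: asboolP => [hT|/contrapT hT].
  by rewrite -[leLHS]addr0; apply: lerD; [apply: ler_piMr|apply: mulr_ge0].
rewrite add0r ler_wpM2l // ler_pdivrMr //.
have [x [xinj xcyc]] := disjoint_cycles k0 lk hkm hT.
set c := (k.+1 %/ 4)%N in ham err err0 *.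
pose idx := [seq (i, b) | i <- iota 0 m, b <- iota 0 c].
pose T := [seq (x ib.1 (4 * ib.2)%N, x ib.1 (4 * ib.2 + 1)%N, x ib.1 (4 * ib.2 + 2)%N) | ib <- idx].
have idxP i b : ((i, b) \in idx) = (i < m)%N && (b < c)%N.
  apply/allpairsP/andP => [[[i' b'] [/=]]|[im bc]].
    by rewrite !mem_iota !add0n => h1 h2 [-> ->].
  by exists (i, b); rewrite /= !mem_iota.
have idxU : uniq idx.
  by apply: allpairs_uniq; rewrite ?iota_uniq // => -[? ?] [? ?] _ _ [-> ->].
have cP b d : (b < c)%N -> (d < 3)%N -> (4 * b + d < k)%N.
  by rewrite /c => h1 h2; have := leq_trunc_div k.+1 4; nia.
have szT : size T = (m * c)%N by rewrite size_map size_allpairs !size_iota.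
have ptsE : triple_points T = [seq x ib.1 (4 * ib.2 + d)%N | ib <- idx, d <- iota 0 3].
  rewrite /triple_points /T -map_comp; congr flatten; apply: eq_map => -[i b] /=.
  by rewrite addn0.
have Tu : uniq (triple_points T).
  have lt3 d : d \in [:: 0; 1; 2]%N -> (d < 3)%N by rewrite !inE => /or3P[]/eqP->.
  rewrite ptsE; apply: allpairs_uniq => //.
  move=> [[i b] d] [[i' b'] d'] /allpairsP[[[i1 b1] d1] [+ + ->]].
  rewrite idxP => /andP[i1m b1c] /lt3 d13.
  move=> /allpairsP[[[i2 b2] d2] [+ + ->]].
  rewrite idxP => /andP[i2m b2c] /lt3 d23 /=.
  move=> h; have [-> h2] := xinj _ _ _ _ i1m (cP _ _ b1c d13) i2m (cP _ _ b2c d23) h.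
  rewrite /= in d13 d23 h2; have hb : b1 = b2 by lia.
  by have hd : d1 = d2; [lia|rewrite hb hd].
pose Y v z := [set s : {perm 'I_n} |
   (count (fun t => good_triple (nbr G v) (nbr G z) (perm_triple s t)) T <= n %/ e)%N].
have XY : X \subset \bigcup_(v : 'I_n) \bigcup_(z : 'I_n) Y v z.
  apply/subsetP => s; rewrite inE => /asboolP hX.
  apply: contrapT => hs; apply: hX.
  exists (fun i j => s (x i j)); split.
  - by move=> i j i' j' im jk im' jk' /perm_inj; apply: xinj.
  - by move=> i j im jk; rewrite adj_perm_graph; apply: xcyc.
  move=> v z; rewrite leqNgt; apply/negP => hlt; apply: hs.
  apply/bigcupP; exists v => //; apply/bigcupP; exists z => //; rewrite inE.
  rewrite leq_divRL // mulnC ltnW // (leq_ltn_trans _ hlt) // leq_mul2l; apply/orP; right.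
  rewrite count_map -size_filter -(size_map (fun ib => s (x ib.1 (4 * ib.2 + 1)%N))).
  rewrite -(card_uniqP _).
    apply/subset_leq_card/subsetP => y /mapP[[i b]].
    rewrite mem_filter /= idxP => /andP[+ /andP[im bc]] ->.
    rewrite /good_triple /perm_triple /= !inE => /and3P[h1 h2 h3].
    apply/existsP; exists (Ordinal im); apply/existsP; exists (Ordinal bc).
    by rewrite /= eqxx h1 h2 h3.
  rewrite map_inj_in_uniq ?filter_uniq // => -[i b] [i' b'].
  rewrite !mem_filter !idxP => /andP[_ /andP[im bc]] /andP[_ /andP[im' bc']] /perm_inj /= h.
  have [-> h2] := xinj _ _ _ _ im (cP b 1%N bc isT) im' (cP b' 1%N bc' isT) h.
  by have -> : b = b' by lia.
have hY v z : #|Y v z|%:R <= err / (n ^ 2)%:R * #|{perm 'I_n}|%:R :> R.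
  have n0 : (n ^ 2)%:R != 0 :> R.
    by rewrite pnatr_eq0 -lt0n expn_gt0 (leq_ltn_trans (leq0n _) (ltn_ord v)).
  rewrite /err [X in X / _]mulrC mulfK // -szT; apply: few_good_triples => //.
  by rewrite szT.
apply: (@le_trans _ _ (\sum_(v : 'I_n) \sum_(z : 'I_n) #|Y v z|%:R)).
  under [leRHS]eq_bigr => v _ do rewrite -natr_sum.
  rewrite -natr_sum ler_nat (leq_trans (subset_leq_card XY)) //.
  by apply: leq_trans (leq_card_bigcup _) _; apply: leq_sum => v _; exact: leq_card_bigcup.
apply: (@le_trans _ _ (\sum_(v : 'I_n) \sum_(z : 'I_n) err / (n ^ 2)%:R * #|{perm 'I_n}|%:R)).
  by apply: ler_sum => v _; apply: ler_sum => z _.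
rewrite !sumr_const card_ord -mulrnA -[leLHS]mulr_natr mulnn mulrAC.
case: (posnP n) => [n0|n0]; last by rewrite divfK // pnatr_eq0 -lt0n expn_gt0 n0.
by rewrite n0 mulr0 mul0r mulr_ge0 // ltW.
Qed.

End Gadgets.

(** * Asymptotic existence of gadgets *)

Section GadgetsAas.
Import mathcomp.boot.fintype mathcomp.boot.finset.
Local Set Implicit Arguments.
Local Unset Strict Implicit.
Local Unset Printing Implicit Defensive.
Variable R : realType.

(** Put y = n/e. Then 2^h <= exp(y), while the hypothesis on N bounds the other power by exp(-2y);
    and exp(y) >= (y/3)^3 absorbs n^2. *)
Lemma gadgets_error_bound (n a e h N : nat) : (0 < a)%N -> (0 < e)%N -> (0 < n)%N ->
  (h * e <= n)%N -> (32 * a ^ 3 * n <= e * N)%N ->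
  (n ^ 2)%:R * (2 ^+ h * (1 - (16 * a ^ 3)%:R^-1) ^+ N) <= (27 * e ^ 3)%:R / n%:R :> R.
Proof.
move=> a0 e0 n0 hh hN; set A := (16 * a ^ 3)%N.
have A0 : (0 < A)%N by rewrite muln_gt0 expn_gt0 a0.
have A0R : 0 < A%:R :> R by rewrite ltr0n.
have e0R : 0 < e%:R :> R by rewrite ltr0n.
have n0R : 0 < n%:R :> R by rewrite ltr0n.
pose y : R := n%:R / e%:R.
have hy : h%:R <= y by rewrite ler_pdivlMr // -natrM ler_nat.
have Ny : 2 * y <= N%:R / A%:R.
  rewrite /y ler_pdivlMr // -mulrA mulrCA mulrAC ler_pdivrMr //.
  by rewrite -!natrM ler_nat mulnC; move: hN; rewrite /A; lia.
have two_le : (2 : R) <= expR 1 by have := expR_ge1Dx (1 : R); lra.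
have h1 : 2 ^+ h <= expR y :> R.
  apply: le_trans (_ : expR 1 ^+ h <= _).
    by rewrite lerXn2r // nnegrE ?expR_ge0.
  by rewrite -expRM_natl mulr1 ler_expR.
have Ai1 : A%:R^-1 <= 1 :> R by rewrite invf_le1 // ler1n.
have h2 : (1 - A%:R^-1) ^+ N <= expR (- (2 * y)) :> R.
  apply: le_trans (_ : expR (- A%:R^-1) ^+ N <= _).
    rewrite lerXn2r // ?nnegrE ?expR_ge0 ?subr_ge0 //; exact: expR_ge1Dx.
  by rewrite -expRM_natl ler_expR mulrN lerN2.
have h3 : (n%:R / (3 * e%:R)) ^+ 3 <= expR y :> R.
  have -> : y = 3%:R * (n%:R / (3 * e%:R)).
    by rewrite /y; field; rewrite gt_eqF.
  rewrite expRM_natl; apply: lerXn2r; rewrite ?nnegrE ?expR_ge0 ?divr_ge0 ?mulr_ge0 //.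
  by have := expR_ge1Dx (n%:R / (3 * e%:R) : R); lra.
apply: (@le_trans _ _ ((n ^ 2)%:R * expR (- y))).
  rewrite ler_wpM2l // (_ : - y = y + - (2 * y)); last by ring.
  by rewrite expRD; apply: ler_pM; rewrite ?exprn_ge0 // subr_ge0.
rewrite expRN ler_pdivrMr ?expR_gt0 //.
apply: le_trans (_ : (27 * e ^ 3)%:R / n%:R * (n%:R / (3 * e%:R)) ^+ 3 <= _).
  rewrite le_eqVlt; apply/orP; left; apply/eqP; rewrite natrM !natrX; field.
  by rewrite !gt_eqF.
by rewrite ler_wpM2l // divr_ge0.
Qed.

Variable p : nat -> R.
Hypothesis p01 : forall n, 0 <= p n <= 1.
Variable l : nat.
Hypothesis l3 : (3 <= l)%N.
Hypothesis p_omega : forall C : R,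
  \forall n \near \oo%classic, C <= p n * n%:R `^ ((l%:R - 1) / l%:R).
Variables (Ga : forall n, graph n) (a : nat).
Hypothesis a0 : (0 < a)%N.
Hypothesis Ga_nbr : \forall n \near \oo%classic, forall v, (n <= a * #|nbr (Ga n) v|)%N.

(** The bound on [M] leaves room both for the disjoint cycles and for revealing all triples of the
    permutation. In the bound on [e], 64 is twice the 32 of [gadgets_error_bound], because rounding
    n/M may lose a factor 2. *)
Lemma aas_gadgets k M e : (l <= k)%N -> (4 * a * k <= M)%N ->
  (64 * a ^ 3 * M <= e * (k.+1 %/ 4))%N ->
  aas p (fun n H => gadgets k (n %/ M) e (Ga n) H).
Proof.
move=> lk hM he d d0.
have k3 := leq_trans l3 lk.
have k0 : (0 < k)%N by rewrite (leq_trans _ k3).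
have M0 : (0 < M)%N by rewrite (leq_trans _ hM) // !muln_gt0 a0.
have e0 : (0 < e)%N.
  rewrite lt0n; apply: contraTneq he => ->.
  by rewrite -ltnNge mul0n muln_gt0 M0 muln_gt0 expn_gt0 a0.
have d20 : 0 < d / 2 by rewrite divr_gt0.
have hT := aas_transversal_ge p01 l3 p_omega lk (isT : (0 < 2)%N) d20.
near=> n.
have hn0 : (0 < n)%N by near: n; exact: nbhs_infty_ge.
have hn : (2 * M <= n)%N by near: n; exact: nbhs_infty_ge.
have hm := leq_trunc_div n M.
have c_le : (4 * (k.+1 %/ 4) <= k.+1)%N by rewrite mulnC leq_trunc_div.
set m := (n %/ M)%N in hm *; set c := (k.+1 %/ 4)%N in he c_le *.
have hmak : (m * (4 * a * k) <= n)%N by rewrite (leq_trans _ hm) // leq_mul2l hM orbT.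
have hmm : (n <= 2 * M * m)%N.
  rewrite {1}(divn_eq n M) -/m; have := ltn_pmod n M0.
  have : (0 < m)%N by rewrite divn_gt0 // (leq_trans _ hn) // leq_pmull.
  by nia.
apply: le_trans (gnp_prob_not_gadgets (a := a) (l := l) (e := e) (p01 n) k0 lk e0 _ _ _) _.
- by apply: leq_trans hmak; nia.
- by apply: leq_trans hmak; rewrite -/c; nia.
- by near: n.
rewrite [leRHS](splitr d); apply: lerD.
  by near: n; exact: hT.
apply: le_trans (gadgets_error_bound a0 e0 hn0 (leq_trunc_div n e) _) _.
  apply: leq_trans (_ : 64 * a ^ 3 * M * m <= _)%N; last first.
    by rewrite -/c [leqRHS]mulnCA [leqLHS]mulnC leq_mul2l he orbT.
  apply: leq_trans (leq_mul (leqnn (32 * a ^ 3)) hmm) _.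
  by rewrite leq_eqVlt; apply/orP; left; apply/eqP; ring.
rewrite ler_pdivrMr ?ltr0n // mulrC -ler_pdivrMr //.
by near: n; exact: nbhs_infty_ger.
Unshelve. all: by end_near. Qed.

End GadgetsAas.

(** * Completing a partial embedding *)

Section Completion.
Import mathcomp.boot.fintype mathcomp.boot.finset.
Local Set Implicit Arguments.
Local Unset Strict Implicit.
Local Unset Printing Implicit Defensive.
Local Open Scope nat_scope.

Lemma adj_sym n (G : graph n) u v : adj G u v = adj G v u.
Proof. by rewrite /adj setUC. Qed.

Lemma adj_union n (G H : graph n) u v :
  adj (graph_union G H) u v = adj G u v || adj H u v.
Proof. by rewrite /adj inE. Qed.

(** A product of disjoint transpositions. Exchanging values, rather than reassigning them, keeps the
    partial embedding a permutation of all vertices. *)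
Lemma exists_swap (T : finType) (xs ys : seq T) x0 :
  uniq (xs ++ ys) -> size xs = size ys ->
  exists s : {perm T},
    [/\ forall j, j < size xs -> s (nth x0 xs j) = nth x0 ys j,
        forall j, j < size xs -> s (nth x0 ys j) = nth x0 xs j
      & forall z, z \notin xs ++ ys -> s z = z].
Proof.
elim: xs ys => [|x xs IH] [|y ys] //= => [_ _|].
  by exists 1%g; split=> // z _; rewrite perm1.
move=> /andP[]; rewrite mem_cat inE !negb_or => /and3P[xxs xy xys].
rewrite cat_uniq /= => /and4P[uxs]; rewrite negb_or => /andP[yxs hxy] yys uys [sz].
have [|s [s1 s2 s3]] := IH ys _ sz; first by rewrite cat_uniq uxs hxy uys.
have sx : s x = x by rewrite s3 // mem_cat negb_or xxs.
have sy : s y = y by rewrite s3 // mem_cat negb_or yxs.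
have neq z w : z \in xs ++ ys -> w \notin xs ++ ys -> w != z.
  by move=> hz; apply: contraNneq => ->.
have xN : x \notin xs ++ ys by rewrite mem_cat negb_or xxs.
have yN : y \notin xs ++ ys by rewrite mem_cat negb_or yxs.
exists (tperm x y * s)%g; split.
- move=> [|j] /=; first by rewrite permM tpermL sy.
  rewrite ltnS => hj; rewrite permM tpermD ?s1 //.
    by apply: neq; rewrite // mem_cat mem_nth.
  by apply: neq; rewrite // mem_cat mem_nth.
- move=> [|j] /=; first by rewrite permM tpermR sx.
  rewrite ltnS => hj; rewrite permM tpermD ?s2 //.
    by apply: neq; rewrite // mem_cat mem_nth ?orbT // -sz.
  by apply: neq; rewrite // mem_cat mem_nth ?orbT // -sz.
- move=> z; rewrite inE mem_cat inE !negb_or => /and4P[zx zxs zy zys].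
  by rewrite permM tpermD 1?eq_sym // s3 // mem_cat negb_or zxs.
Qed.

Lemma exists_perm_map (T : finType) (x0 : T) (xs ys : seq T) : uniq xs -> uniq ys ->
  size xs = size ys ->
  exists s : {perm T}, forall j, j < size xs -> s (nth x0 xs j) = nth x0 ys j.
Proof.
elim: xs ys => [|x xs IH] [|y ys] //=; first by exists 1%g.
move=> /andP[xxs uxs] /andP[yys uys] [sz]; have [s hs] := IH ys uxs uys sz.
exists (s * tperm (s x) y)%g => -[|j] /=; first by rewrite permM tpermL.
rewrite ltnS => hj; rewrite permM hs // tpermD //.
  by rewrite -hs // (inj_eq perm_inj); apply: contraNneq xxs => ->; rewrite mem_nth.
by apply: contraNneq yys => ->; rewrite mem_nth // -sz.
Qed.

Variables (n l : nat) (x0 : 'I_n) (F G H : graph n).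

(** The pairs for which [transversal_cycles] provides an edge: the closing pair is included only if
    [l <= size b]. *)
Definition cyc_link (b : seq 'I_n) u w := exists j,
  [/\ j < size b, (j.+1 < size b) || (l <= size b), u = nth x0 b j
    & w = nth x0 b (j.+1 %% size b)].

(* A task is a list of vertices still to be embedded together; the flag tells
   whether its ends have neighbours outside of it. *)
Definition task_ok (X : {set 'I_n}) (t : bool * seq 'I_n) := exists y1 y2,
  [/\ t.1 -> [/\ y1 \in X, y2 \in X & 1 < size t.2]
    & forall u w, u \in t.2 -> adj F u w ->
        (cyc_link t.2 u w \/ cyc_link t.2 w u) \/
        t.1 /\ ((u = nth x0 t.2 0 /\ w = y1) \/ (u = nth x0 t.2 (size t.2).-1 /\ w = y2))].

Lemma task_okS (X X' : {set 'I_n}) t : X \subset X' -> task_ok X t -> task_ok X' t.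
Proof.
move=> /subsetP XX' [y1 [y2 [h1 h2]]]; exists y1, y2; split=> // /h1[? ? ?].
by split=> //; apply: XX'.
Qed.

Definition swappable (f : {perm 'I_n}) (C : {set 'I_n}) v z :=
  [set w in C | [forall u, adj F w u ==> adj G v (f u)] && adj G z (f w)].

(** [X] is the embedded part and [C] the centres not yet used. Vertices of [X :\: C] never move
    again; by [st_nbr] all neighbours of a centre are among them, so several centres can move at
    once without interfering. *)
Record state_ok (f : {perm 'I_n}) (X C : {set 'I_n}) : Prop := StateOk {
  st_hom : forall u w, u \in X -> w \in X -> adj F u w -> adj (graph_union G H) (f u) (f w);
  st_sub : C \subset X;
  st_nbr : forall w u, w \in C -> adj F w u -> u \in X :\: C }.

Definition tasks_cover (X : {set 'I_n}) (ts : seq (bool * seq 'I_n)) :=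
  uniq (flatten (map snd ts)) /\ forall u, (u \in flatten (map snd ts)) = (u \notin X).

(** A bound for the centres still to be consumed: two for each attached task, for its ends, and one
    for each of the last [r0] vertices. *)
Definition budget r0 (ts : seq (bool * seq 'I_n)) :=
  2 * count (fun t => t.1) ts + minn (size (flatten (map snd ts))) r0.

Lemma sub_swappable (f f' : {perm 'I_n}) (C C' D : {set 'I_n}) v z : C' \subset C ->
  (forall w, w \in C' -> f' w = f w) ->
  (forall w u, w \in C' -> adj F w u -> f' u = f u) ->
  C :\: C' \subset D -> #|swappable f C v z| <= #|swappable f' C' v z| + #|D|.
Proof.
move=> /subsetP sC hf hf' /subsetP hD.
apply: leq_trans (leq_card_setU _ _); apply/subset_leq_card/subsetP => w.
rewrite !inE => /andP[wC /andP[/forallP h1 h2]].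
case: (boolP (w \in C')) => wC' /=; last by rewrite (hD w) ?orbT // inE wC' wC.
rewrite hf // h2 andbT; apply/orP; left; apply/forallP => u; apply/implyP => wu.
by rewrite (hf' w) //; have := h1 u; rewrite wu.
Qed.

Variables (c r0 h S : nat).
Hypothesis hH : forall s, 0 < s <= S -> transversal_cycles l s c H.
Hypothesis h_large : n <= c * h.
Hypothesis r0_large : n <= c * (r0 - S).

Lemma complete_step f (X C : {set 'I_n}) t ts :
  state_ok f X C -> tasks_cover X (t :: ts) ->
  (forall t', t' \in t :: ts -> task_ok (X :\: C) t' /\ 0 < size t'.2 <= S) ->
  (forall v z, h + budget r0 (t :: ts) <= #|swappable f C v z|) ->
  exists f' X' C', [/\ state_ok f' X' C', tasks_cover X' ts,
    forall t', t' \in ts -> task_ok (X' :\: C') t' /\ 0 < size t'.2 <= S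
    & forall v z, h + budget r0 ts <= #|swappable f' C' v z|].
Proof.
case: t => att b [hom CX Cnbr] [] /=; rewrite cat_uniq => /and3P[ub /hasPn bts uts] cov hts hbud.
have [[y1 [y2 /= [hatt hlink]]] /= /andP[s0 sS]] := hts (att, b) (mem_head _ _).
set s := size b in hatt hlink s0 sS.
set tot := size (flatten (map snd ((att, b) :: ts))).
have totE : tot = #|~: X|.
  rewrite /tot /= -(card_uniqP _).
    by apply: eq_card => u; rewrite cov !inE.
  by rewrite cat_uniq ub uts andbT; apply/hasPn.
have bX u : u \in b -> u \notin X by move=> ub'; rewrite -cov mem_cat ub'.
(* The positions that take over the place of a centre: the ends of an attached task, and all
   positions once at most [r0] vertices remain. *)
pose sw (j : nat) := att && ((j == 0) || (j == s.-1)) || (tot <= r0).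
pose z (j : nat) := if j == 0 then f y1 else f y2.
(* The places of [b] itself are left out, so that the exchange is between disjoint lists; they
   number at most [S], which explains [r0 - S] in [r0_large]. *)
pose W (j : nat) := if sw j then [set f w | w in swappable f C (f (nth x0 b j)) (z j)]
            else [set f w | w in ~: X :\: [set u in b]].
have hs : 0 < s <= S by rewrite s0 sS.
have [|tg [tg1 tg2 tg3]] := hH hs (W := W).
  move=> j js; rewrite /W; case: ifP => hsw; rewrite card_imset; try exact: perm_inj.
    by rewrite (leq_trans h_large) // leq_mul2l (leq_trans (leq_addr _ _) (hbud _ _)) orbT.
  rewrite (leq_trans r0_large) // leq_mul2l; apply/orP; right.
  have cb : #|[set u in b]| <= S by rewrite cardsE (leq_trans (card_size b)).
  move/negbT: hsw; rewrite negb_or -ltnNge totE => /andP[_ hr].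
  rewrite cardsD leq_sub ?(ltnW hr) // (leq_trans _ cb) //.
  by apply/subset_leq_card/subsetIr.
set ys := [seq tg j | j <- iota 0 s].
have ysP y : reflect (exists2 j, j < s & y = tg j) (y \in ys).
  apply: (iffP mapP) => -[j].
    by rewrite mem_iota => hj ->; exists j.
  by move=> hj ->; exists j; rewrite // mem_iota.
have W_b j : j < s -> forall u, u \in b -> tg j != f u.
  move=> js u ubb; have := tg1 j js; rewrite /W; case: ifP => _ /imsetP[w hw ->].
    rewrite (inj_eq perm_inj); apply: contraTneq hw => ->; rewrite inE.
    by rewrite (contraNF (subsetP CX u)) // bX.
  rewrite (inj_eq perm_inj); apply: contraTneq hw => ->.
  by rewrite !inE ubb.
have ys_nth j : j < s -> nth x0 ys j = tg j.
  by move=> js; rewrite (nth_map 0) ?size_iota // nth_iota.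
have xs_nth j : j < s -> nth x0 (map f b) j = f (nth x0 b j).
  by move=> js; rewrite (nth_map x0).
have [||sg [sg1 sg2 sg3]] := @exists_swap _ (map f b) ys x0.
- rewrite cat_uniq map_inj_uniq ?ub /=; last exact: perm_inj.
  apply/andP; split; first by apply/hasPn => y /ysP[j js ->]; apply/negP => /mapP[u ubb e];
    move: (W_b j js u ubb); rewrite e eqxx.
  rewrite map_inj_in_uniq ?iota_uniq // => i j; rewrite !mem_iota; exact: tg2.
- by rewrite !size_map size_iota.
rewrite size_map in sg1 sg2.
pose f' := (f * sg)%g.
have f'b j : j < s -> f' (nth x0 b j) = tg j.
  by move=> js; rewrite permM -xs_nth // sg1 // ys_nth.
have f't w j : j < s -> f w = tg j -> f' w = f (nth x0 b j).
  by move=> js e; rewrite permM e -ys_nth // sg2 // xs_nth.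
have f'id w : w \notin b -> f w \notin ys -> f' w = f w.
  move=> wb wy; rewrite permM sg3 // mem_cat negb_or wy andbT.
  by rewrite mem_map //; exact: perm_inj.
have tgX w j : w \in X -> j < s -> f w = tg j ->
    sw j /\ w \in swappable f C (f (nth x0 b j)) (z j).
  move=> wX js e; have := tg1 j js; rewrite /W -e; case: ifP => hsw; rewrite mem_imset; try exact: perm_inj.
    by [].
  by rewrite !inE wX andbF.
have XN w : w \in X -> w \notin b by apply: contraTN => /bX.
have XCid w : w \in X :\: C -> f' w = f w.
  rewrite inE => /andP[wC wX]; apply: f'id; first exact: XN.
  apply/ysP => -[j js /(tgX w j wX js)[_]]; rewrite inE => /andP[wC' _].
  by rewrite wC' in wC.
pose D := [set w in C | f w \in ys].
pose C' := C :\: D.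
pose X' := X :|: [set u in b].
have C'id w : w \in C' -> f' w = f w.
  rewrite !inE negb_and => /andP[/orP[/negP//|wy] wC].
  by apply: f'id => //; apply/XN/(subsetP CX).
have homb u w : u \in b -> w \in X' -> adj F u w -> adj (graph_union G H) (f' u) (f' w).
  move=> ubb wX' uw; rewrite adj_union; case: (hlink u w ubb uw).
    case=> -[j [js jl -> ->]]; have js' : j.+1 %% s < s by rewrite ltn_pmod.
      by rewrite (f'b _ js) (f'b _ js') (tg3 j js jl) orbT.
    by rewrite (f'b _ js) (f'b _ js') [adj H _ _]adj_sym (tg3 j js jl) orbT.
  case=> ha; have [y1X y2X s1] := hatt ha.
  have hsw0 : sw 0 by rewrite /sw ha.
  have hsw1 : sw s.-1 by rewrite /sw ha eqxx orbT.
  have s1s : s.-1 < s by rewrite prednK.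
  case=> -[-> ->].
    rewrite f'b // (XCid _ y1X) adj_sym.
    have := tg1 0 s0; rewrite /W hsw0 => /imsetP[w' hw' ->].
    by move: hw'; rewrite inE => /and3P[_ _ ->].
  rewrite f'b // (XCid _ y2X) adj_sym.
  have := tg1 _ s1s; rewrite /W hsw1 => /imsetP[w' hw' ->].
  move: hw'; rewrite inE /z => /and3P[_ _]; case: ifP => [/eqP e|_ -> //].
  (* [1 < s] separates the two ends, so the last position was chosen next to [f y2] and not
     [f y1]. *)
  by move: s1; rewrite -(prednK s0) e.
have homX u w : u \in X -> w \in X -> adj F u w -> f u \in ys ->
    adj (graph_union G H) (f' u) (f' w).
  move=> uX wX uw /ysP[j js e]; have [_] := tgX u j uX js e.
  rewrite inE => /and3P[uC /forallP/(_ w) + _]; rewrite uw /= => h1.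
  by rewrite (f't _ _ js e) XCid ?(Cnbr _ _ uC uw) // adj_union h1.
exists f', X', C'; split.
- split.
  + move=> u w uX' wX' uw.
    case: (boolP (u \in b)) => [ubb|ub']; first exact: homb.
    case: (boolP (w \in b)) => [wbb|wb'].
      by rewrite adj_sym; apply: homb => //; rewrite adj_sym.
    move: uX' wX'; rewrite !inE (negbTE ub') (negbTE wb') !orbF => uX wX.
    case: (boolP (f u \in ys)) => [|uy]; first exact: homX.
    case: (boolP (f w \in ys)) => [|wy].
      by rewrite adj_sym; apply: homX => //; rewrite adj_sym.
    by rewrite !f'id //; apply: hom.
  + by apply: subset_trans (subsetDl _ _) (subset_trans CX (subsetUl _ _)).
  + move=> w u; rewrite inE => /andP[_ wC] wu; have := Cnbr w u wC wu.
    by rewrite !inE => /andP[uC uX]; rewrite (negbTE uC) uX !andbF.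
- split=> // u; rewrite !inE negb_or -cov mem_cat.
  case: (boolP (u \in b)) => ubb /=; last by rewrite andbT.
  by apply/negbTE; apply: contraL ubb => /bts.
- move=> t' ht'; have [h1 h2] := hts t' (mem_behead (s := (att, b) :: ts) ht'); split=> //.
  apply: task_okS h1; apply/subsetP => u; rewrite !inE => /andP[uC uX].
  by rewrite (negbTE uC) uX !andbF.
move=> v z'.
(* [D] consists of the centres consumed now. In the last stage they number at most [s], the drop of
   the second term of the budget; before that, only the ends of an attached task consume any. *)
have cD : budget r0 ts + #|D| <= budget r0 ((att, b) :: ts).
  have cDi : #|D| = #|[set f w | w in D]| by rewrite card_imset //; exact: perm_inj.
  have totS : tot = s + size (flatten (map snd ts)) by rewrite /tot /= size_cat.
  rewrite /budget [count _ (_ :: _)]/= -/tot mulnDr.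
  case: (leqP tot r0) => htot.
    have : #|D| <= s.
      have szy : size ys = s by rewrite size_map size_iota.
      rewrite cDi -szy; apply: leq_trans (card_size ys); apply/subset_leq_card/subsetP => _ /imsetP[w + ->].
      by rewrite inE => /andP[].
    by rewrite totS; have := geq_minl (size (flatten (map snd ts))) r0; lia.
  have : #|D| <= 2 * att.
    have DX w : w \in D -> exists2 j, att && ((j == 0) || (j == s.-1)) & f w = tg j.
      rewrite inE => /andP[wC /ysP[j js e]]; exists j => //.
      have [] := tgX w j (subsetP CX w wC) js e.
      by rewrite /sw leqNgt htot orbF.
    rewrite cDi; case: (att) DX => DX.
      apply: leq_trans (_ : #|[set tg 0; tg s.-1]| <= _); last by rewrite cards2; case: (_ != _).
      apply/subset_leq_card/subsetP => _ /imsetP[w /DX[j /= hj ->] ->].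
      by rewrite !inE; case/orP: hj => /eqP ->; rewrite eqxx ?orbT.
    rewrite (_ : D = set0) ?imset0 ?cards0 //.
    by apply/setP => w; rewrite in_set0; apply/negP => /DX[j].
  by have := geq_minr (size (flatten (map snd ts))) r0; lia.
have hsub : #|swappable f C v z'| <= #|swappable f' C' v z'| + #|D|.
  apply: sub_swappable; first exact: subsetDl.
  - exact: C'id.
  - move=> w u; rewrite inE => /andP[_ wC] wu; apply: XCid; exact: Cnbr wC wu.
  - by rewrite /C' setDDr setDv set0U subsetIr.
rewrite -(leq_add2r #|D|) (leq_trans _ hsub) // (leq_trans _ (hbud v z')) //.
by rewrite -addnA leq_add2l.
Qed.

Lemma complete_tasks ts f (X C : {set 'I_n}) :
  state_ok f X C -> tasks_cover X ts ->
  (forall t, t \in ts -> task_ok (X :\: C) t /\ 0 < size t.2 <= S) ->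
  (forall v z, h + budget r0 ts <= #|swappable f C v z|) ->
  contains (graph_union G H) F.
Proof.
elim: ts f X C => [|t ts IH] f X C hst hcov hts hbud.
  exists f; first exact: perm_inj.
  have XT u : u \in X by apply: negbNE; rewrite -hcov.2 in_nil.
  by move=> u w; apply: st_hom hst _ _ _ _.
have [f' [X' [C' [? ? ? ?]]]] := complete_step hst hcov hts hbud.
exact: (IH f' X' C').
Qed.

End Completion.

(** * Graphs of maximum degree two *)

Section Decomposition.
Import mathcomp.boot.fintype mathcomp.boot.finset.
Local Set Implicit Arguments.
Local Unset Strict Implicit.
Local Unset Printing Implicit Defensive.
Local Open Scope nat_scope.

(** * Consecutive elements of lists and cyclic lists *)

Section Linked.
Variables (T : eqType) (x0 : T).
Implicit Types (b s r : seq T) (u w : T).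

Definition linked b u w := exists j,
  [/\ j.+1 < size b, u = nth x0 b j & w = nth x0 b j.+1].

Definition clinked b u w :=
  linked b u w \/ [/\ 0 < size b, u = last x0 b & w = head x0 b].

Lemma linked_catl s r u w : linked s u w -> linked (s ++ r) u w.
Proof.
move=> [j [js -> ->]]; exists j; rewrite size_cat !nth_cat js (ltnW js).
by rewrite ltn_addr.
Qed.

Lemma linked_catr s r u w : linked r u w -> linked (s ++ r) u w.
Proof.
move=> [j [js -> ->]]; exists (size s + j); rewrite size_cat -addnS ltn_add2l js.
by rewrite !nth_cat !(ltnNge _ (size s)) !leq_addr /= !addKn.
Qed.

Lemma linked_cat s r u w : linked (s ++ r) u w -> [\/ linked s u w, linked r u w |
  [/\ 0 < size s, 0 < size r, u = last x0 s & w = head x0 r]].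
Proof.
move=> [j [js -> ->]]; rewrite size_cat in js; rewrite !nth_cat.
case: (ltngtP j.+1 (size s)) => h.
- by constructor 1; exists j.
- constructor 2; exists (j - size s).
  by rewrite -subSn // ltn_subLR // ltnW.
- rewrite h subnn nth0; constructor 3; split=> //.
  + by rewrite -h.
  + by move: js; rewrite -h; lia.
  + by rewrite -nth_last -h.
Qed.

Lemma last_cat_pos s r : 0 < size r -> last x0 (s ++ r) = last x0 r.
Proof. by rewrite last_cat; case: r. Qed.

Lemma head_cat_pos s r : 0 < size s -> head x0 (s ++ r) = head x0 s.
Proof. by case: s. Qed.

Lemma linked_join s r : 0 < size s -> 0 < size r ->
  linked (s ++ r) (last x0 s) (head x0 r).
Proof.
move=> s0 r0; exists (size s).-1; rewrite size_cat prednK // !nth_cat.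
rewrite prednK // leqnn ltnn subnn nth0 nth_last; split=> //.
by rewrite -addn1 leq_add2l.
Qed.

Lemma clinked_rot s r u w : clinked (s ++ r) u w -> clinked (r ++ s) u w.
Proof.
case: (posnP (size s)) => [/size0nil ->|s0]; first by rewrite cats0.
case: (posnP (size r)) => [/size0nil ->|r0]; first by rewrite cats0.
case=> [/linked_cat[h|h|[_ _ -> ->]]|[_ -> ->]].
- by left; apply: linked_catr.
- by left; apply: linked_catl.
- by right; rewrite size_cat addn_gt0 r0 last_cat_pos // head_cat_pos.
- by left; rewrite last_cat_pos // head_cat_pos //; apply: linked_join.
Qed.

Lemma linked_mem b u w : linked b u w -> u \in b /\ w \in b.
Proof. by move=> [j [js -> ->]]; rewrite !mem_nth // ltnW. Qed.

Lemma clinked_mem b u w : clinked b u w -> u \in b /\ w \in b.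
Proof.
case=> [/linked_mem//|[b0 -> ->]]; rewrite -nth_last -nth0 !mem_nth //.
by rewrite prednK.
Qed.

(** Writing [head x0 (r ++ b)] covers the case of empty [r], where [b] is the whole cycle and its
    last element is followed by its own head. *)
Lemma clinked_next b r u w : uniq (b ++ r) -> u \in b -> clinked (b ++ r) u w ->
  linked b u w \/ (u = last x0 b /\ w = head x0 (r ++ b)).
Proof.
rewrite cat_uniq => /and3P[_ /hasPn bdr _] ub.
have ur : u \notin r by apply: contraL ub => /bdr.
have b0 : 0 < size b by case: (b) ub.
case: (posnP (size r)) => [/size0nil re|r0].
  by rewrite re cats0 => -[h|[_ -> ->]]; [left|right].
rewrite head_cat_pos //; case=> [/linked_cat[h|/linked_mem[h _]|[_ _ -> ->]]|[_ hu _]].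
- by left.
- by rewrite h in ur.
- by right.
- by move: ur; rewrite hu last_cat_pos // -nth_last mem_nth // prednK.
Qed.

Lemma clinked_prev b r u w : uniq (b ++ r) -> u \in b -> clinked (b ++ r) w u ->
  linked b w u \/ (u = head x0 b /\ w = last x0 (b ++ r)).
Proof.
rewrite cat_uniq => /and3P[_ /hasPn bdr _] ub.
have ur : u \notin r by apply: contraL ub => /bdr.
have b0 : 0 < size b by case: (b) ub.
case: (posnP (size r)) => [/size0nil re|r0].
  by rewrite re cats0 => -[h|[_ -> ->]]; [left|right].
case=> [/linked_cat[h|/linked_mem[_ h]|[_ _ _ hu]]|[_ -> ->]].
- by left.
- by rewrite h in ur.
- by move: ur; rewrite hu -nth0 mem_nth.
- by right; rewrite head_cat_pos.
Qed.

End Linked.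

Variables (n l : nat) (x0 : 'I_n) (F : graph n).
Hypothesis l3 : 3 <= l.
Hypothesis deg2 : max_degree F <= 2.
Hypothesis girth : girth_ge l F.

Lemma adj_irr u : adj F u u = false.
Proof.
apply/negP => /(subsetP (edges_pairs F)).
by rewrite inE setUid cards1.
Qed.

Lemma adj_two u a b w : adj F u a -> adj F u b -> a != b -> adj F u w -> w = a \/ w = b.
Proof.
move=> ua ub ab uw; case: (w =P a) => [|/eqP wa]; first by left.
case: (w =P b) => [|/eqP wb]; first by right.
have : #|[set a; b; w]| <= 2.
  apply: (leq_trans _ (leq_trans (leq_bigmax (F := degree F) u) deg2)).
  apply/subset_leq_card/subsetP => z; rewrite !inE => /orP[/orP[]|] /eqP -> //.
rewrite (_ : [set a; b; w] = w |: [set a; b]); last by rewrite setUC.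
by rewrite cardsU1 cards2 !inE negb_or wa wb ab.
Qed.

Lemma longest_path (S : {set 'I_n}) x : x \in S ->
  exists q : seq 'I_n, [/\ 0 < size q, uniq q, {subset q <= S}, sorted (adj F) q
    & forall q', uniq q' -> {subset q' <= S} -> sorted (adj F) q' -> size q' <= size q].
Proof.
move=> xS.
pose P i := [exists q : i.-tuple 'I_n, [&& uniq q, all (mem S) q & sorted (adj F) q]].
have PP q : uniq q -> {subset q <= S} -> sorted (adj F) q -> P (size q).
  move=> h1 h2 h3; apply/existsP; exists (in_tuple q); rewrite /= h1 h3 andbT.
  exact/allP.
have exP : exists i, P i by exists 1; apply: (PP [:: x]) => // y; rewrite inE => /eqP ->.
have ubP i : P i -> i <= n.
  case/existsP => q /and3P[uq _ _]; rewrite -(size_tuple q) -(card_uniqP uq).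
  by rewrite -[X in _ <= X]card_ord max_card.
case: (ex_maxnP exP ubP) => i /existsP[q /and3P[uq /allP qS sq]] maxi.
exists q; split=> //.
  by rewrite size_tuple; apply: (maxi 1); apply: (PP [:: x]) => // y; rewrite inE => /eqP ->.
by move=> q' h1 h2 h3; rewrite size_tuple; apply/maxi/PP.
Qed.

Lemma sorted_adj_nth q j : sorted (adj F) q -> j.+1 < size q ->
  adj F (nth x0 q j) (nth x0 q j.+1).
Proof. by case: q => [|y q] //= /(pathP x0); apply. Qed.

Lemma sorted_rcons_adj q w : sorted (adj F) q -> adj F (last x0 q) w -> sorted (adj F) (rcons q w).
Proof. by case: q => [|y q] //= hq hw; rewrite rcons_path hq. Qed.

(* A longest path [q] is a whole component: its inner vertices already have two
   neighbours on [q], and its ends have no neighbour outside of [q]. *)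
Lemma component_path (S : {set 'I_n}) x : x \in S ->
  (forall u w, u \in S -> adj F u w -> w \in S) ->
  exists q : seq 'I_n, [/\ 0 < size q, uniq q, {subset q <= S} &
    (forall u w, u \in q -> adj F u w -> linked x0 q u w \/ linked x0 q w u) \/
    l <= size q /\
    (forall u w, u \in q -> adj F u w -> clinked x0 q u w \/ clinked x0 q w u)].
Proof.
move=> xS cl; have [q [q0 uq qS sq qmax]] := longest_path xS.
exists q; split=> //.
have q0q : nth x0 q 0 \in q by rewrite mem_nth.
have qlq : last x0 q \in q by rewrite -nth_last mem_nth // prednK.
have hhead w : adj F (nth x0 q 0) w -> w \in q.
  move=> hw; apply: contraT => wq; have := qmax (w :: q).
  rewrite /= wq uq ltnn => h; apply: h => //.
    move=> y; rewrite inE => /predU1P[->|/qS//].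
    by apply: cl hw; apply: qS.
  by case: (q) hw sq => //= y q' hw ->; rewrite adj_sym hw.
have hlast w : adj F (last x0 q) w -> w \in q.
  move=> hw; apply: contraT => wq; have := qmax (rcons q w).
  rewrite rcons_uniq wq uq size_rcons ltnn => h; apply: h => //.
    move=> y; rewrite mem_rcons inE => /predU1P[->|/qS//].
    by apply: cl hw; apply: qS.
  exact: sorted_rcons_adj.
have nq i j : i < size q -> j < size q -> nth x0 q i = nth x0 q j -> i = j.
  by move=> hi hj /eqP; rewrite nth_uniq // => /eqP.
have inner j w : 0 < j -> j.+1 < size q -> adj F (nth x0 q j) w ->
    w = nth x0 q j.-1 \/ w = nth x0 q j.+1.
  move=> j0 js; apply: adj_two.
  - by rewrite adj_sym; have := sorted_adj_nth sq (j := j.-1); rewrite prednK //; apply; apply: ltnW.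
  - exact: sorted_adj_nth.
  - have h1 : j.-1 < size q by apply: leq_ltn_trans (leq_pred j) (ltnW js).
    by rewrite (nth_uniq x0 h1 js uq); apply/eqP; lia.
have innerL j w : 0 < j -> j.+1 < size q -> adj F (nth x0 q j) w ->
    linked x0 q (nth x0 q j) w \/ linked x0 q w (nth x0 q j).
  move=> j0 js hw; case: (inner j w j0 js hw) => ->.
    by right; exists j.-1; rewrite prednK // (ltnW js).
  by left; exists j.
have headL w : adj F (nth x0 q 0) w ->
    linked x0 q (nth x0 q 0) w \/ w = last x0 q.
  move=> hw; have /(nthP x0)[i iq hi] := hhead w hw; rewrite -hi in hw *.
  have i0 : 0 < i by rewrite lt0n; apply: contraTneq hw => ->; rewrite adj_irr.
  case: (ltngtP i.+1 (size q)) iq => // [iq _|iq _]; last by right; rewrite -nth_last -iq.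
  left; rewrite adj_sym in hw; case: (inner _ _ i0 iq hw) => /nq h.
    have i1 : 0 = i.-1 by apply: h => //; apply: leq_ltn_trans (leq_pred i) _; apply: ltnW.
    have e : i = 1 by lia.
    by rewrite e in iq *; exists 0; split=> //; apply: ltnW.
  by have := h q0 iq.
have lastL w : adj F (last x0 q) w -> linked x0 q w (last x0 q) \/ w = nth x0 q 0.
  move=> hw; have /(nthP x0)[i iq hi] := hlast w hw; rewrite -hi in hw *.
  case: (posnP i) => [->|i0]; first by right.
  have iq1 : i.+1 < size q.
    rewrite ltn_neqAle iq andbT; apply: contraTneq hw => e.
    by rewrite -nth_last -e adj_irr.
  left; rewrite adj_sym -nth_last in hw; case: (inner _ _ i0 iq1 hw) => /nq h.
    by have e : (size q).-1 = i.-1; [apply: h; lia|lia].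
  exists i; rewrite iq1 -nth_last; split=> //; congr nth.
  by apply: h; lia.
(* If the ends close the path to a cycle, the girth bounds its length. Otherwise the ends are not
   adjacent, or the path has at most two vertices and a closing edge would already be an edge of the
   path. *)
case: (boolP (adj F (last x0 q) (nth x0 q 0) && (2 < size q))) => [/andP[hcl q3]|hno].
  right; split.
    apply: girth; rewrite /is_cycle q3 /ucycleb uq andbT.
    case: (q) q3 hcl sq => //= y q' _ hcl sq.
    by rewrite rcons_path sq.
  move=> u w /(nthP x0)[j js <-] hw.
  case: (posnP j) hw => [-> hw|j0 hw].
    case: (headL w hw) => [h|->]; first by left; left.
    by right; right; rewrite nth0.
  case: (ltngtP j.+1 (size q)) js => // [jq _|jq _].
    by case: (innerL j w j0 jq hw) => h; [left|right]; left.
  have jl : nth x0 q j = last x0 q by rewrite -nth_last -jq.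
  rewrite jl in hw *; case: (lastL w hw) => [h|->]; first by right; left.
  by left; right; rewrite nth0.
have close2 : adj F (last x0 q) (nth x0 q 0) -> linked x0 q (nth x0 q 0) (last x0 q).
  move=> hc; move: hno; rewrite hc /= -leqNgt => q2; exists 0; rewrite -nth_last.
  have q1 : 1 < size q.
    rewrite ltn_neqAle q0 andbT; apply: contraTneq hc => e.
    by rewrite -nth_last -e adj_irr.
  by have -> : (size q).-1 = 1 by lia.
left=> u w /(nthP x0)[j js <-] hw.
case: (posnP j) hw => [-> hw|j0 hw].
  case: (headL w hw) => [h|e]; first by left.
  by left; rewrite e; apply: close2; rewrite adj_sym -e.
case: (ltngtP j.+1 (size q)) js => // [jq _|jq _]; first exact: innerL.
have jl : nth x0 q j = last x0 q by rewrite -nth_last -jq.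
rewrite jl in hw *; case: (lastL w hw) => [h|e]; first by right.
by right; rewrite e; apply: close2; rewrite -e.
Qed.

Definition comp_adj p (cs : seq (seq 'I_n)) u w :=
  (linked x0 p u w \/ linked x0 p w u) \/
  exists2 c, c \in cs & clinked x0 c u w \/ clinked x0 c w u.

(** All path components are concatenated into the single list [p]. This links vertices that are not
    adjacent, which amounts to embedding a graph with more edges and is harmless. *)
Lemma decompose_closed m (S : {set 'I_n}) : #|S| <= m ->
  (forall u w, u \in S -> adj F u w -> w \in S) ->
  exists p (cs : seq (seq 'I_n)), [/\ uniq (p ++ flatten cs),
    forall u, (u \in p ++ flatten cs) = (u \in S),
    all (fun c => l <= size c) cs &
    forall u w, u \in S -> adj F u w -> comp_adj p cs u w].
Proof.
elim: m S => [|m IH] S.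
  rewrite leqn0 cards_eq0 => /eqP -> _; exists [::], [::]; split=> // u.
    by rewrite inE.
  by move=> w; rewrite inE.
move=> cS cl; have [->|[x xS]] := set_0Vmem S.
  by exists [::], [::]; split=> // [u|u w]; rewrite in_set0 ?in_nil.
have [q [q0 uq qS hq]] := component_path xS cl.
have qcl u w : u \in q -> adj F u w -> w \in q.
  move=> uq' uw; case: hq => [h|[_ h]]; case: (h u w uq' uw).
  - by case/linked_mem. - by case/linked_mem.
  - by case/clinked_mem. - by case/clinked_mem.
pose S' := S :\: [set u in q].
have cl' u w : u \in S' -> adj F u w -> w \in S'.
  rewrite !inE => /andP[uq' uS] uw; rewrite (cl u w uS uw) andbT.
  by apply: contra uq' => wq; apply: (qcl w u wq); rewrite adj_sym.
have [|p [cs [ucs memcs lcs hcs]]] := IH S' _ cl'.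
  rewrite -ltnS (leq_trans _ cS) //; apply/proper_card/properP; split; first exact: subsetDl.
  have yq : nth x0 q 0 \in q by rewrite mem_nth.
  by exists (nth x0 q 0); [apply: qS|rewrite !inE yq].
have disj : ~~ has (mem q) (p ++ flatten cs).
  by apply/hasPn => u; rewrite memcs !inE => /andP[].
have mem_or u : (u \in q) || (u \in S') = (u \in S).
  by rewrite !inE; case: (boolP (u \in q)) => [/qS ->|].
case: hq => [hq|[lq hq]].
  exists (q ++ p), cs; split=> //.
  - by rewrite -catA cat_uniq uq disj ucs.
  - by move=> u; rewrite -catA mem_cat memcs mem_or.
  - move=> u w; rewrite -mem_or => /orP[uq' /(hq u w uq')|uS /(hcs u w uS)].
      by case=> h; left; [left|right]; apply: linked_catl.
    by case=> [[h|h]|h]; [left; left; apply: linked_catr|left; right; apply: linked_catr|right].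
exists p, (q :: cs).
have pe : perm_eq (p ++ flatten (q :: cs)) (q ++ p ++ flatten cs).
  by rewrite /= perm_catCA.
split=> //.
- by rewrite (perm_uniq pe) cat_uniq uq disj ucs.
- by move=> u; rewrite (perm_mem pe) mem_cat memcs mem_or.
- by rewrite /= lq.
- move=> u w; rewrite -mem_or => /orP[uq' /(hq u w uq') h|uS /(hcs u w uS)].
    by right; exists q => //; rewrite inE eqxx.
  by case=> [h|[c cc h]]; [left|right; exists c => //; rewrite inE cc orbT].
Qed.

(** For the same reason [p] may be closed up to a cycle as soon as it has at least [l] vertices, so
    fewer than [l] vertices ever lie outside of cycles. *)
Lemma decompose : exists p (cs : seq (seq 'I_n)), [/\ uniq (p ++ flatten cs),
    forall u, u \in p ++ flatten cs, size p < l,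
    all (fun c => l <= size c) cs &
    forall u w, adj F u w -> comp_adj p cs u w].
Proof.
have [||p [cs [h1 h2 h3 h4]]] := @decompose_closed n [set: 'I_n].
- by rewrite cardsT card_ord.
- by move=> u w _ _; rewrite inE.
case: (ltnP (size p) l) => hp.
  exists p, cs; split=> // [u|u w]; first by rewrite h2 inE.
  by apply: h4; rewrite inE.
exists [::], (p :: cs); split=> // [u| | |u w /h4]; first by rewrite h2 inE.
- by rewrite (leq_trans _ l3).
- by rewrite /= hp.
rewrite inE => /(_ isT)[h|[c cc h]]; last by right; exists c => //; rewrite inE cc orbT.
by right; exists p; rewrite ?mem_head //; case: h => h; [left|right]; left.
Qed.

End Decomposition.

(** * Choosing the pieces *)

Section Plan.
Import mathcomp.boot.fintype mathcomp.boot.finset.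
Local Set Implicit Arguments.
Local Unset Strict Implicit.
Local Unset Printing Implicit Defensive.
Local Open Scope nat_scope.

Lemma flatten_uniq_eq (T : eqType) (ss : seq (seq T)) c c' u : uniq (flatten ss) ->
  c \in ss -> c' \in ss -> u \in c -> u \in c' -> c = c'.
Proof.
elim: ss => //= s ss IH; rewrite cat_uniq => /and3P[_ /hasPn hs uss].
have no d : d \in ss -> u \in d -> u \notin s.
  by move=> hd ud; apply: hs; apply/flattenP; exists d.
rewrite !inE => /predU1P[->|cs] /predU1P[->|cs'] // uc uc'.
- by have := no _ cs' uc'; rewrite uc.
- by have := no _ cs uc; rewrite uc'.
- exact: IH.
Qed.

Lemma chop (T : eqType) D (c : seq T) : 0 < D -> D <= size c ->
  exists2 ch : seq (seq T), flatten ch = c & all (fun t => D <= size t < 2 * D) ch.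
Proof.
move=> D0; elim: {c}(size c) {-2}c (leqnn (size c)) => [|m IH] c hc Dc.
  by have := leq_trans D0 (leq_trans Dc hc).
case: (ltnP (size c) (2 * D)) => h; first by exists [:: c]; rewrite /= ?cats0 ?Dc ?h.
have hd : size (drop D c) = size c - D by rewrite size_drop.
have [||ch hch hall] := IH (drop D c); rewrite ?hd; [lia|lia|].
exists (take D c :: ch) => /=; first by rewrite hch cat_take_drop.
by rewrite hall size_takel // leqnn andbT; lia.
Qed.

Lemma chop_all (T : eqType) D (lg : seq (seq T)) : 0 < D -> all (fun c => D <= size c) lg ->
  exists2 css : seq (seq (seq T)), map flatten css = lg
    & all (fun t => D <= size t < 2 * D) (flatten css).
Proof.
move=> D0; elim: lg => [_|c lg IH /= /andP[/(chop D0)[ch h1 h2] /IH[css h3 h4]]].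
  by exists [::].
by exists (ch :: css); rewrite /= ?h1 ?h3 // all_cat h2 h4.
Qed.

Lemma head_flatten (T : eqType) (x0 : T) (ss : seq (seq T)) : 0 < size ss ->
  (forall t, t \in ss -> 0 < size t) ->
  exists2 t, t \in ss & head x0 (flatten ss) = head x0 t.
Proof.
case: ss => //= s ss _ h; exists s; first exact: mem_head.
by rewrite head_cat_pos // h // mem_head.
Qed.

Lemma last_flatten (T : eqType) (x0 : T) (ss : seq (seq T)) : 0 < size ss ->
  (forall t, t \in ss -> 0 < size t) ->
  exists2 t, t \in ss & last x0 (flatten ss) = last x0 t.
Proof.
case/lastP: ss => // ss s _ h; exists s; first by rewrite mem_rcons mem_head.
by rewrite flatten_rcons last_cat_pos // h // mem_rcons mem_head.
Qed.

Lemma flatten_flatten (T : Type) (sss : seq (seq (seq T))) :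
  flatten (map flatten sss) = flatten (flatten sss).
Proof. by elim: sss => //= ss sss ->; rewrite flatten_cat. Qed.

Lemma perm_flatten_split (T : eqType) (S : Type) (f g h : S -> seq T) (s : seq S) :
  (forall t, f t = g t ++ h t) ->
  perm_eq (flatten (map f s)) (flatten (map g s) ++ flatten (map h s)).
Proof.
move=> e; apply/seq.permP => a; elim: s => //= t s IH.
by rewrite e !count_cat IH count_cat; lia.
Qed.

Lemma perm_flatten_filter (T : eqType) (S : Type) (f : S -> seq T) (a : pred S) (s : seq S) :
  perm_eq (flatten (map f s))
    (flatten [seq f t | t <- s & a t] ++ flatten [seq f t | t <- s & ~~ a t]).
Proof.
apply/seq.permP => b; elim: s => //= t s IH.
by case: (a t); rewrite /= !count_cat IH !count_cat; lia.
Qed.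

(** [b < k.+1 %/ 4] means exactly 4b + 2 < k: the gadget fits without wrapping around, and its
    centre is not an end of the list. *)
Lemma center_bounds k b : b < k.+1 %/ 4 ->
  [/\ 0 < k, 4 * b + 1 < k, 4 * b + 2 < k, (4 * b + 1 == 0) = false
    & (4 * b + 1 == k.-1) = false].
Proof.
have := leq_trunc_div k.+1 4; move: (k.+1 %/ 4) => q hq hb.
by split; try apply/eqP; lia.
Qed.

Variables (n l : nat) (x0 : 'I_n) (F : graph n).
Hypothesis l3 : 3 <= l.

Definition centers k (g : seq (seq 'I_n)) : {set 'I_n} :=
  [set u | has (fun gi => has (fun b => u == nth x0 gi (4 * b + 1)) (iota 0 (k.+1 %/ 4))) g].

(* [g] : vertices to be mapped onto gadgets; [Z] : vertices placed arbitrarily;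
   [ts] : the remaining tasks. *)
Record plan k m D (g : seq (seq 'I_n)) (Z : seq 'I_n) (ts : seq (bool * seq 'I_n)) : Prop := Plan {
  pl_size : size g = m;
  pl_k : all (fun gi => size gi == k) g;
  pl_uniq : uniq (flatten g ++ Z);
  pl_cover : tasks_cover [set u in flatten g ++ Z] ts;
  pl_adj : forall u w, u \in flatten g ++ Z -> w \in flatten g ++ Z -> adj F u w ->
    exists2 gi, gi \in g & clinked x0 gi u w \/ clinked x0 gi w u;
  pl_nbr : forall gi b w, gi \in g -> b < k.+1 %/ 4 -> adj F (nth x0 gi (4 * b + 1)) w ->
    w = nth x0 gi (4 * b) \/ w = nth x0 gi (4 * b + 2);
  pl_task : forall t, t \in ts ->
    task_ok l x0 F ([set u in flatten g ++ Z] :\: centers k g) t /\ 0 < size t.2 <= 2 * D;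
  pl_count : count (fun t => t.1) ts * D <= n }.

Lemma linked_cyc_link b u w : linked x0 b u w -> cyc_link l x0 b u w.
Proof. by move=> [j [js -> ->]]; exists j; rewrite js (ltnW js) modn_small. Qed.

Lemma clinked_cyc_link b u w : l <= size b -> clinked x0 b u w -> cyc_link l x0 b u w.
Proof.
move=> lb [/linked_cyc_link//|[b0 -> ->]]; exists (size b).-1.
by rewrite prednK // leqnn lb orbT modnn nth_last nth0.
Qed.

Lemma linked_nth_inner b j w : uniq b -> j.+1 < size b ->
  (linked x0 b (nth x0 b j) w -> w = nth x0 b j.+1) /\
  (linked x0 b w (nth x0 b j) -> w = nth x0 b j.-1).
Proof.
move=> ub jb; split=> [[i [ib /eqP + ->]]|[i [ib -> /eqP]]].
  by rewrite nth_uniq // ?(ltnW ib) ?(ltnW jb) // => /eqP ->.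
by rewrite nth_uniq // ?(ltnW jb) // => /eqP ->.
Qed.

Lemma clinked_nth_inner b j w : uniq b -> 0 < j -> j.+1 < size b ->
  clinked x0 b (nth x0 b j) w \/ clinked x0 b w (nth x0 b j) ->
  w = nth x0 b j.-1 \/ w = nth x0 b j.+1.
Proof.
move=> ub j0 jb; have [h1 h2] := linked_nth_inner w ub jb.
have js := ltnW jb; have b0 : 0 < size b by apply: leq_ltn_trans jb.
case=> [[/h1 ->|[_ + _]]|[/h2 ->|[_ _]]]; [by right| |by left|].
  move/eqP; rewrite -nth_last nth_uniq // ?prednK // => /eqP e.
  by move: jb; rewrite e prednK // ltnn.
by move/eqP; rewrite -nth0 nth_uniq // => /eqP e; rewrite e in j0.
Qed.

(** Every piece is cut into a prefix placed beforehand and a [gap] that becomes an attached task.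
    The prefix has [k] vertices if the piece carries gadgets and one otherwise, so the gap always
    has its outer neighbours embedded: the last vertex of its own prefix and the first vertex of the
    next one. [k + 2 <= D] leaves at least two vertices in the gap, as an attached task requires. *)
Lemma plan_gen p cs gs sh (css : seq (seq (seq 'I_n))) (isg : pred (seq 'I_n)) k D :
  uniq (p ++ flatten cs) -> (forall u, u \in p ++ flatten cs) -> size p < l ->
  all (fun c => l <= size c) cs -> (forall u w, adj F u w -> comp_adj x0 p cs u w) ->
  perm_eq cs (gs ++ sh ++ map flatten css) ->
  l <= 2 * D -> 3 <= k -> k + 2 <= D ->
  all (fun c => size c == k) gs -> all (fun c => size c <= 2 * D) sh ->
  all (fun t => D <= size t < 2 * D) (flatten css) ->
  exists g Z ts, plan k (size gs + count isg (flatten css)) D g Z ts.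
Proof.
move=> ucs tot pl lcs adjcs pcs lD k3 kD kgs Dsh /allP Dchs.
set chs := flatten css in Dchs *.
pose pre t := take (if isg t then k else 1) t.
pose gap t := drop (if isg t then k else 1) t.
have preS t : t \in chs -> size (pre t) = if isg t then k else 1.
  move=> /Dchs/andP[h _]; rewrite size_takel //; apply: leq_trans h.
  by case: ifP => _; lia.
have pre0 t : t \in chs -> 0 < size (pre t).
  by move=> /preS ->; case: ifP => _; lia.
have gapS t : t \in chs -> 1 < size (gap t) <= 2 * D.
  move=> /Dchs/andP[]; rewrite /gap size_drop; move: (size t) => s h h'.
  by case: ifP => _; apply/andP; split; lia.
have tE t : t = pre t ++ gap t by rewrite cat_take_drop.
have D0 : 0 < D by lia.
have t0 t : t \in chs -> 0 < size t by move=> /Dchs/andP[h _]; apply: leq_trans h.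
pose g := gs ++ [seq pre t | t <- chs & isg t].
pose Z := flatten [seq pre t | t <- chs & ~~ isg t].
pose tk := [seq (false, c) | c <- sh] ++ [seq (true, gap t) | t <- chs].
(* Tasks must be nonempty, so an empty [p] gives none. *)
pose ts := if p is [::] then tk else (false, p) :: tk.
have mem_ts t : t \in ts -> [\/ t = (false, p) /\ 0 < size p,
    exists2 c, c \in sh & t = (false, c) | exists2 c, c \in chs & t = (true, gap c)].
  have htk : t \in tk -> [\/ t = (false, p) /\ 0 < size p,
    exists2 c, c \in sh & t = (false, c) | exists2 c, c \in chs & t = (true, gap c)].
    by rewrite mem_cat => /orP[]/mapP[c hc ->]; [constructor 2|constructor 3]; exists c.
  rewrite /ts; case: (p) htk => [|y p'] htk //; rewrite inE => /predU1P[->|/htk//].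
  by constructor 1.
have tsE : flatten (map snd ts) = p ++ flatten sh ++ flatten (map gap chs).
  have tkE : flatten (map snd tk) = flatten sh ++ flatten (map gap chs).
    by rewrite /tk map_cat flatten_cat -!map_comp map_id_in.
  by rewrite /ts; case: (p) => [|y p'] /=; rewrite tkE.
have hperm : perm_eq (p ++ flatten cs) ((flatten g ++ Z) ++ flatten (map snd ts)).
  rewrite tsE; apply/seq.permP => a.
  have /seq.permP/(_ a) h1 := perm_flatten pcs.
  have /seq.permP/(_ a) h2 : perm_eq (flatten chs) (flatten (map pre chs) ++ flatten (map gap chs)).
    by rewrite -[in X in perm_eq X _](map_id chs); apply: perm_flatten_split.
  have /seq.permP/(_ a) h3 := perm_flatten_filter pre isg chs.
  move: h1; rewrite !flatten_cat flatten_flatten -/chs !count_cat => h1.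
  move: h2 h3; rewrite !count_cat => h2 h3.
  rewrite /Z ?flatten_cat ?count_cat h1 h2 h3.
  by repeat match goal with |- context [count a ?x] => move: (count a x) => ? end; lia.
have uall := ucs; rewrite (perm_uniq hperm) cat_uniq in uall.
have {uall}/and3P[uX /hasPn XT uT] := uall.
have uflat : uniq (flatten cs) by move: ucs; rewrite cat_uniq => /and3P[].
have pX u c : c \in cs -> u \in c -> u \notin p.
  move=> hc uc; move: ucs; rewrite cat_uniq => /and3P[_ /hasPn h _]; apply: h.
  by apply/flattenP; exists c.
have adj_comp c u w : c \in cs -> u \in c -> adj F u w -> clinked x0 c u w \/ clinked x0 c w u.
  move=> hc uc /adjcs[[/linked_mem[]|/linked_mem[]]|].
  - by rewrite (negbTE (pX u c hc uc)).
  - by move=> _; rewrite (negbTE (pX u c hc uc)).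
  - case=> c' hc' h; rewrite (flatten_uniq_eq uflat hc hc' uc) //.
    by case: h => /clinked_mem[].
have csI c : c \in gs ++ sh ++ map flatten css -> c \in cs by rewrite -(perm_mem pcs).
have chunk t : t \in chs -> exists r, [/\ uniq (t ++ r),
    forall u w, u \in t -> adj F u w -> clinked x0 (t ++ r) u w \/ clinked x0 (t ++ r) w u,
    exists2 t', t' \in chs & head x0 (r ++ t) = head x0 t'
    & exists2 t', t' \in chs & last x0 (t ++ r) = last x0 t'].
  move=> /flattenP[ch hch tch]; have chc : {subset ch <= chs}.
    by move=> t' ht'; apply/flattenP; exists ch.
  have hc : flatten ch \in cs by apply: csI; rewrite !mem_cat map_f ?orbT.
  have uc : uniq (flatten ch).
    have /perm_uniq := perm_flatten (perm_to_rem hc); rewrite uflat /= => /esym.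
    by rewrite cat_uniq => /and3P[].
  case/splitPr: tch chc hc uc => l1 l2 chc hc uc.
  exists (flatten l2 ++ flatten l1).
  have pe : perm_eq (flatten (l1 ++ t :: l2)) (t ++ flatten l2 ++ flatten l1).
    by rewrite flatten_cat /= perm_catC -catA.
  split.
  - by rewrite -(perm_uniq pe).
  - move=> u w ut uw; have uin : u \in flatten (l1 ++ t :: l2).
      by rewrite (perm_mem pe) mem_cat ut.
    rewrite catA; move: (adj_comp _ _ _ hc uin uw); rewrite flatten_cat /=.
    by case=> h; [left|right]; apply: clinked_rot.
  - have := @head_flatten _ x0 (l2 ++ l1 ++ [:: t]); rewrite !flatten_cat /= cats0 !catA.
    have sub t' : t' \in (l2 ++ l1) ++ [:: t] -> t' \in chs.
      by move=> h; apply: chc; move: h; rewrite !mem_cat !inE; case/orP => [/orP[]|] ->; rewrite ?orbT.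
    case=> [|t' /sub/t0//|t' /sub ht' ->]; last by exists t'.
    by rewrite size_cat addn1.
  - have := @last_flatten _ x0 (t :: l2 ++ l1); rewrite /= !flatten_cat.
    have sub t' : t' \in t :: l2 ++ l1 -> t' \in chs.
      by move=> h; apply: chc; move: h; rewrite !(mem_cat, inE); case/or3P => ->; rewrite ?orbT.
    by case=> [//|t' /sub/t0//|t' /sub ht' ->]; exists t'.
have preX t : t \in chs -> {subset pre t <= flatten g ++ Z}.
  move=> ht u ut; rewrite mem_cat /g flatten_cat mem_cat.
  case: (boolP (isg t)) => ig.
    by apply/orP; left; apply/orP; right; apply/flattenP; exists (pre t); rewrite ?map_f // mem_filter ig.
  by apply/orP; right; apply/flattenP; exists (pre t); rewrite ?map_f // mem_filter ig.
have gapT t : t \in chs -> {subset gap t <= flatten (map snd ts)}.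
  move=> ht u ut; rewrite tsE !mem_cat; apply/orP; right; apply/orP; right.
  by apply/flattenP; exists (gap t); rewrite ?map_f.
have headpre t : t \in chs -> head x0 t = head x0 (pre t).
  by move=> ht; rewrite {1}(tE t) head_cat_pos // pre0.
have lastgap t : t \in chs -> last x0 t = last x0 (gap t).
  by move=> ht; rewrite {1}(tE t) last_cat_pos //; have /andP[/ltnW] := gapS t ht.
have memlast b : 0 < size b -> last x0 b \in b.
  by move=> b0; rewrite -nth_last mem_nth // prednK.
have memhead b : 0 < size b -> head x0 b \in b.
  by move=> b0; rewrite -nth0 mem_nth.
have pre_nbr t u w : t \in chs -> u \in pre t -> adj F u w ->
    [\/ linked x0 (pre t) u w, linked x0 (pre t) w u,
        u = last x0 (pre t) /\ w \in flatten (map snd ts)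
      | u = head x0 (pre t) /\ w \in flatten (map snd ts)].
  move=> ht ut uw; have [r [ur hr _ [t' ht' hl]]] := chunk t ht.
  have utt : u \in t by rewrite (tE t) mem_cat ut.
  have g0 : 0 < size (gap t) by have /andP[/ltnW] := gapS t ht.
  have g0' : 0 < size (gap t') by have /andP[/ltnW] := gapS t' ht'.
  have tr : t ++ r = pre t ++ (gap t ++ r) by rewrite catA -tE.
  rewrite tr in ur; case: (hr u w utt uw); rewrite tr => h.
    case: (clinked_next ur ut h) => [?|[-> ->]]; first by constructor 1.
    constructor 3; split=> //; apply: (gapT t ht).
    by rewrite -catA head_cat_pos // memhead.
  case: (clinked_prev ur ut h) => [?|[-> ->]]; first by constructor 2.
  constructor 4; split=> //; apply: (gapT t' ht').
  by rewrite -tr hl lastgap // memlast.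
have uflatg : uniq (flatten g) by move: uX; rewrite cat_uniq => /and3P[].
have gk : all (fun gi => size gi == k) g.
  rewrite /g all_cat kgs /=; apply/allP => gi /mapP[t]; rewrite mem_filter => /andP[ig ht] ->.
  by rewrite preS // ig.
have ugi gi : gi \in g -> uniq gi.
  move=> hg; have /perm_uniq := perm_flatten (perm_to_rem hg); rewrite uflatg /= => /esym.
  by rewrite cat_uniq => /and3P[].
(* Attached tasks hang on ends of prefixes; these are not centres, so they stay where they are. *)
have notcenter t y : t \in chs -> y = head x0 (pre t) \/ y = last x0 (pre t) ->
    y \in [set u in flatten g ++ Z] :\: centers k g.
  move=> ht hy.
  have yp : y \in pre t by case: hy => ->; [apply: memhead|apply: memlast]; apply: pre0.
  rewrite !inE (preX t ht) // andbT; apply/negP => /hasP[gi hgi /hasP[b]].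
  rewrite mem_iota add0n => /andP[_ /center_bounds[k0 hb1 hb ne0 nek]] /eqP yE.
  have sgi : size gi = k by apply/eqP; apply: (allP gk).
  have ygi : y \in gi by rewrite yE mem_nth // sgi.
  have ygf : y \in flatten g by apply/flattenP; exists gi.
  case: (boolP (isg t)) => ig; last first.
    move: uX; rewrite cat_uniq => /and3P[_ /hasPn h _].
    have yZ : y \in Z by apply/flattenP; exists (pre t); rewrite ?map_f // mem_filter ig.
    by have := h y yZ; rewrite /= ygf.
  have hpg : pre t \in g by rewrite mem_cat map_f ?orbT // mem_filter ig.
  have e := flatten_uniq_eq uflatg hpg hgi yp ygi.
  have ut := ugi _ hgi; rewrite e in hy; move: hy; rewrite yE -nth0 -nth_last sgi.
  by case=> /eqP; rewrite nth_uniq // ?sgi ?prednK // ?ne0 ?nek.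
exists g, Z, ts; split=> //.
- by rewrite size_cat size_map size_filter.
- split=> // u; rewrite inE; have := tot u; rewrite (perm_mem hperm) mem_cat.
  case: (boolP (u \in flatten (map snd ts))) => [/XT/negbTE ->//|_]; by rewrite orbF => ->.
- move=> u w uX' wX' uw.
  have wT : w \notin flatten (map snd ts) by apply: contraL wX' => /XT.
  have : u \in flatten gs \/ exists2 t, t \in chs & u \in pre t.
    move: uX'; rewrite mem_cat /g flatten_cat mem_cat => /orP[/orP[->|]|]; first by left.
      by case/flattenP => c /mapP[t]; rewrite mem_filter => /andP[_ ht] -> ut; right; exists t.
    by case/flattenP => c /mapP[t]; rewrite mem_filter => /andP[_ ht] -> ut; right; exists t.
  case=> [/flattenP[c hc uc]|[t ht ut]].
    exists c; first by rewrite mem_cat hc.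
    by apply: adj_comp => //; apply: csI; rewrite mem_cat hc.
  have lk a b : linked x0 (pre t) a b -> isg t.
    by move=> [j [js _ _]]; apply: contraTT js => /negbTE hg; rewrite preS // hg.
  have hg a b : linked x0 (pre t) a b -> pre t \in g.
    by move=> /lk ig; rewrite mem_cat map_f ?orbT // mem_filter ig.
  case: (pre_nbr t u w ht ut uw) => [h|h|[_ h]|[_ h]].
  + by exists (pre t); [apply: hg h|left; left].
  + by exists (pre t); [apply: hg h|right; left].
  + by rewrite h in wT.
  + by rewrite h in wT.
- move=> gi b w hgi /center_bounds[k0 hb1 hb ne0 nek] hw; have sgi : size gi = k by apply/eqP; apply: (allP gk).
  have ut := ugi _ hgi.
  have hin : nth x0 gi (4 * b + 1) \in gi by rewrite mem_nth // sgi.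
  have hcl : clinked x0 gi (nth x0 gi (4 * b + 1)) w \/ clinked x0 gi w (nth x0 gi (4 * b + 1)).
    move: hgi; rewrite mem_cat => /orP[hgs|/mapP[t]].
      by apply: adj_comp => //; apply: csI; rewrite mem_cat hgs.
    rewrite mem_filter => /andP[ig ht] e; rewrite e in hin hw ut sgi *.
    case: (pre_nbr t _ w ht hin hw) => [h|h|[/eqP h _]|[/eqP h _]]; [by left; left|by right; left| |].
      by move: h; rewrite -nth_last nth_uniq // ?sgi ?prednK // nek.
    by move: h; rewrite -nth0 nth_uniq // ?sgi // ne0.
  have [||->|->] := clinked_nth_inner ut _ _ hcl.
  + by rewrite addn1.
  + by rewrite sgi -addnS.
  + by left; rewrite addn1.
  + by right; rewrite -addnS.
- move=> t /mem_ts[[-> p0]|[c hc ->]|[c hc ->]] /=.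
  + split; last by rewrite p0 (leq_trans (ltnW pl)).
    exists x0, x0; split=> // u w up uw; left.
    case: (adjcs u w uw) => [[]h|[c hc h]]; [by left; apply: linked_cyc_link|by right; apply: linked_cyc_link|].
    have uc : u \in c by case: h => /clinked_mem[].
    by move: up; rewrite (negbTE (pX u c hc uc)).
  + have cc : c \in cs by apply: csI; rewrite !mem_cat hc orbT.
    have lc := allP lcs c cc.
    split; last by rewrite (leq_trans _ lc) ?(leq_trans _ l3) // (allP Dsh).
    exists x0, x0; split=> // u w up uw; left.
    by case: (adj_comp c u w cc up uw) => h; [left|right]; apply: clinked_cyc_link.
  + have /andP[g1 gD] := gapS c hc.
    split; last by rewrite (ltnW g1).
    have [r [ur hr [t' ht' hh] _]] := chunk c hc.
    exists (last x0 (pre c)), (head x0 (pre t')); split=> [_|u w ug uw].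
      by split; [apply: (notcenter c); auto|apply: (notcenter t'); auto|].
    have uc : u \in c by rewrite (tE c) mem_cat ug orbT.
    have g0 := ltnW g1.
    have cr : c ++ r = pre c ++ (gap c ++ r) by rewrite catA -tE.
    have ur' : uniq (gap c ++ (r ++ pre c)).
      by move: ur; rewrite cr uniq_catC -catA.
    have key a b : clinked x0 (c ++ r) a b -> clinked x0 (gap c ++ (r ++ pre c)) a b.
      by rewrite cr => /clinked_rot; rewrite -catA.
    case: (hr u w uc uw) => /key h.
      case: (clinked_next ur' ug h) => [hl|[-> ->]]; first by left; left; apply: linked_cyc_link.
      right; split=> //; right; rewrite nth_last -catA -tE hh headpre //.
    case: (clinked_prev ur' ug h) => [hl|[-> ->]]; first by left; right; apply: linked_cyc_link.
    right; split=> //; left; rewrite nth0 !last_cat_pos ?size_cat ?addn_gt0 ?pre0 ?orbT //.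
- have -> : count (fun t => t.1) ts = size chs.
    have htk : count (fun t => t.1) tk = size chs.
      by rewrite /tk count_cat !count_map (eq_count (a2 := pred0)) // count_pred0 add0n count_predT.
    by rewrite /ts; case: (p).
  have : size (flatten chs) <= n.
    have uch : uniq (flatten chs).
      have /perm_uniq := perm_flatten pcs; rewrite uflat !flatten_cat flatten_flatten => /esym.
      by rewrite !cat_uniq => /and3P[_ _ /and3P[]].
    by rewrite -(card_uniqP uch) -[X in _ <= X]card_ord max_card.
  apply: leq_trans; elim: (chs) Dchs => [|t s IH] h //=.
  rewrite mulSn size_cat leq_add //; first by have /andP[] := h t (mem_head _ _).
  by apply: IH => t' ht'; apply: h; rewrite inE ht' orbT.
Qed.

End Plan.

(** * Embedding *)

Section Embedding.
Import mathcomp.boot.fintype mathcomp.boot.finset.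
Local Set Implicit Arguments.
Local Unset Strict Implicit.
Local Unset Printing Implicit Defensive.
Local Open Scope nat_scope.

Lemma eq_flatten_nth (T : eqType) (x0 : T) (g : seq (seq T)) k :
  all (fun gi => size gi == k) g ->
  flatten g = [seq nth x0 (nth [::] g i) j | i <- iota 0 (size g), j <- iota 0 k].
Proof.
move=> /allP hk; rewrite -[in LHS](mkseq_nth [::] g) /mkseq; congr flatten.
apply/eq_in_map => i; rewrite mem_iota add0n => /= hi.
by rewrite -[LHS](mkseq_nth x0) /mkseq (eqP (hk _ (mem_nth [::] hi))).
Qed.

Lemma exists_initial_perm n (x0 : 'I_n) (g : seq (seq 'I_n)) k (x : nat -> nat -> 'I_n) :
  all (fun gi => size gi == k) g -> uniq (flatten g) ->
  (forall i j i' j', i < size g -> j < k -> i' < size g -> j' < k ->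
     x i j = x i' j' -> i = i' /\ j = j') ->
  exists f : {perm 'I_n}, forall i j, i < size g -> j < k ->
    f (nth x0 (nth [::] g i) j) = x i j.
Proof.
move=> gk ug xinj; set m := size g in xinj *.
pose idx := [seq (i, j) | i <- iota 0 m, j <- iota 0 k].
have mem_idx i j : ((i, j) \in idx) = (i < m) && (j < k).
  apply/allpairsP/andP => [[[i' j'] [/=]]|[im jk]].
    by rewrite !mem_iota !add0n => h1 h2 [-> ->].
  by exists (i, j); rewrite /= !mem_iota.
have uidx : uniq idx.
  by apply: allpairs_uniq; rewrite ?iota_uniq // => -[? ?] [? ?] _ _ [-> ->].
pose us := [seq nth x0 (nth [::] g ij.1) ij.2 | ij <- idx].
pose ys := [seq x ij.1 ij.2 | ij <- idx].
have usE : us = flatten g.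
  by rewrite (eq_flatten_nth x0 gk) /us /idx map_allpairs.
have uys : uniq ys.
  rewrite map_inj_in_uniq // => -[i j] [i' j']; rewrite !mem_idx.
  by move=> /andP[? ?] /andP[? ?] /= /xinj[] // -> ->.
have [|||f hf] := @exists_perm_map _ x0 us ys; rewrite ?usE // -?usE ?size_map //.
exists f => i j im jk; have hij : (i, j) \in idx by rewrite mem_idx im jk.
have hix : index (i, j) idx < size idx by rewrite index_mem.
have := hf (index (i, j) idx); rewrite size_map => /(_ hix).
by rewrite !(nth_map (i, j)) // nth_index.
Qed.

(** Of the n/e centres available for each v, z, the attached tasks consume at most 2n/D <= n/(4e)
    and the last stage n/(4e), while another n/(4e) must remain as target set. The factor 16 in
    [16 * e] covers the rounding of n/(4e) and the loss of [S = 2 * D], which is at most half of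
    [r0] because [16 * e * D <= n]. *)
Lemma embed_plan n l (x0 : 'I_n) (F G H : graph n) k m e D g Z ts :
  l <= k -> 3 <= l -> 0 < e -> 8 * e <= D -> 16 * e * D <= n ->
  plan l x0 F k m D g Z ts -> gadgets k m e G H ->
  (forall s, 0 < s <= 2 * D -> transversal_cycles l s (16 * e) H) ->
  contains (graph_union G H) F.
Proof.
move=> lk l3 e0 eD Dn pl [x [xinj xcyc xcnt]] hT.
have [szg gk ugZ cov adjX nbrC tasks cnt] := pl.
have ug : uniq (flatten g) by move: ugZ; rewrite cat_uniq => /and3P[].
rewrite -szg in xinj xcyc xcnt.
(* [f] is arbitrary outside [flatten g]. This suffices for [Z], since by [pl_adj] every edge inside
   [X] lies on a list of [g]. *)
have [f hf] := exists_initial_perm x0 gk ug xinj.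
have gE gi : gi \in g -> exists2 i, i < size g & gi = nth [::] g i.
  by move=> h; exists (index gi g); rewrite ?index_mem ?nth_index.
have gS gi : gi \in g -> size gi = k by move=> h; apply/eqP; apply: (allP gk).
have gX gi u : gi \in g -> u \in gi -> u \in flatten g ++ Z.
  by move=> h1 h2; rewrite mem_cat; apply/orP; left; apply/flattenP; exists gi.
set X := [set u in flatten g ++ Z] in cov tasks.
set C := centers x0 k g in tasks.
have ugi gi : gi \in g -> uniq gi.
  move=> hg; have /perm_uniq := perm_flatten (perm_to_rem hg); rewrite ug /= => /esym.
  by rewrite cat_uniq => /and3P[].
have memC u : u \in C -> exists gi b, [/\ gi \in g, b < k.+1 %/ 4 & u = nth x0 gi (4 * b + 1)].
  rewrite inE => /hasP[gi hgi /hasP[b]]; rewrite mem_iota => /andP[_ hb] /eqP ->.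
  by exists gi, b.
have Cmem gi b : gi \in g -> b < k.+1 %/ 4 -> nth x0 gi (4 * b + 1) \in C.
  move=> hgi hb; rewrite inE; apply/hasP; exists gi => //; apply/hasP; exists b => //.
  by rewrite mem_iota.
have notC gi j : gi \in g -> j < k -> j %% 4 != 1 -> nth x0 gi j \notin C.
  move=> hgi jk j1; apply/negP => /memC[gi' [b [hgi' hb]]] e'.
  have [_ hb1 _ _ _] := center_bounds hb.
  have egi : gi = gi'.
    apply: (flatten_uniq_eq (u := nth x0 gi j) ug hgi hgi'); first by rewrite mem_nth ?gS.
    by rewrite e' mem_nth ?gS.
  move: e'; rewrite -egi => /eqP; rewrite nth_uniq ?gS // ?ugi // => /eqP ej.
  by move: j1; rewrite ej mulnC modnMDl.
have hst : state_ok F G H f X C.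
  split.
  - have half u w gi : gi \in g -> clinked x0 gi u w -> adj H (f u) (f w).
      move=> hgi; have [i hi giE] := gE gi hgi; have sgi := gS gi hgi.
      case=> [[j [js -> ->]]|[s0 -> ->]].
        rewrite sgi in js; rewrite giE !hf // ?(ltnW js) //.
        by have := xcyc i j hi (ltnW js); rewrite modn_small.
      rewrite -nth_last -nth0 sgi giE !hf //; try by rewrite -sgi ?prednK.
      by have := xcyc i k.-1 hi; rewrite -sgi prednK // leqnn modnn => /(_ isT).
    move=> u w; rewrite !inE => uX wX /(adjX u w uX wX)[gi hgi [h|h]]; rewrite adj_union.
      by rewrite (half u w gi) ?orbT.
    by rewrite adj_sym [adj H _ _]adj_sym (half w u gi) ?orbT.
  - apply/subsetP => u /memC[gi [b [hgi hb ->]]]; rewrite inE (gX gi) // mem_nth // gS //.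
    by have [] := center_bounds hb.
  - move=> w u /memC[gi [b [hgi hb ->]]] hu; have [_ _ hb2 _ _] := center_bounds hb.
    have hb0 : 4 * b < k by apply: leq_ltn_trans hb2; apply: leq_addr.
    case: (nbrC gi b u hgi hb hu) => ->; rewrite in_setD notC ?inE //= ?(gX gi) ?mem_nth ?gS //.
      by rewrite mulnC modnMl.
    by rewrite mulnC modnMDl.
apply: (complete_tasks (c := 16 * e) (r0 := n %/ (4 * e)) (h := n %/ (4 * e)) (S := 2 * D) _ _ _ hst cov tasks).
- exact: hT.
- have := ltn_ceil n (isT : 0 < 4); have e40 : 0 < 4 * e by rewrite muln_gt0.
  have := ltn_ceil n e40; have : 0 < n %/ (4 * e) by rewrite divn_gt0 //; nia.
  clear; move: (n %/ (4 * e)) => q; nia.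
- have e40 : 0 < 4 * e by rewrite muln_gt0.
  have hq : 4 * D <= n %/ (4 * e) by rewrite leq_divRL //; move: Dn; clear; nia.
  have := ltn_ceil n e40; move: hq e0 eD; clear; move: (n %/ (4 * e)) => q; nia.
move=> v z.
have hsw : n <= e * #|swappable F G f C v z|.
  apply: leq_trans (xcnt v z) _; rewrite leq_mul2l; apply/orP; right.
  rewrite -[X in _ <= X](card_imset _ (@perm_inj _ f)); apply/subset_leq_card/subsetP => y.
  rewrite /gadget_centers in_set => /existsP[[i hi] /existsP[[b hb] /= /and4P[/eqP -> h1 h2 h3]]].
  have [_ hb1 hb2 _ _] := center_bounds hb.
  have hb0 : 4 * b < k by apply: leq_ltn_trans hb2; apply: leq_addr.
  have hgi : nth [::] g i \in g by rewrite mem_nth.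
  apply/imsetP; exists (nth x0 (nth [::] g i) (4 * b + 1)); last by rewrite hf.
  rewrite inE Cmem //= hf // h3 andbT; apply/forallP => u; apply/implyP => hu.
  by case: (nbrC _ b u hgi hb hu) => ->; rewrite hf.
rewrite -(leq_pmul2l e0) (leq_trans _ hsw) //.
have h4 := leq_trunc_div n (4 * e).
have hB : budget (n %/ (4 * e)) ts <= 2 * count (fun t => t.1) ts + n %/ (4 * e).
  by rewrite leq_add2l geq_minr.
apply: leq_trans (_ : e * (n %/ (4 * e) + (2 * count (fun t => t.1) ts + n %/ (4 * e))) <= _).
  by rewrite leq_mul2l leq_add2l hB orbT.
move: h4 cnt eD e0; clear; move: (count _ ts) (n %/ (4 * e)) => c q; nia.
Qed.

Lemma count_size_lt (T : Type) (cs : seq (seq T)) D m :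
  (forall k, k < D -> count (fun c => size c == k) cs <= m) ->
  count (fun c => size c < D) cs <= D * m.
Proof.
elim: D => [_|D IH h]; first by rewrite (eq_count (a2 := pred0)) ?count_pred0.
have h1 : count (fun c => size c < D) cs <= D * m by apply: IH => k kD; apply: h; apply: ltnW.
rewrite mulSn addnC; apply: leq_trans (leq_add h1 (h D (ltnSn D))).
rewrite -count_predUI; apply: leq_trans (leq_addr _ _).
by apply: sub_count => c /=; rewrite ltnS leq_eqVlt orbC.
Qed.

Lemma size_flatten_le (T : Type) (cs : seq (seq T)) D :
  all (fun c => size c <= D) cs -> size (flatten cs) <= D * size cs.
Proof.
elim: cs => //= c cs IH /andP[hc /IH h]; rewrite size_cat mulnS.
exact: leq_add.
Qed.

Lemma uniq_of_flatten (T : eqType) (ss : seq (seq T)) :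
  (forall t, t \in ss -> 0 < size t) -> uniq (flatten ss) -> uniq ss.
Proof.
elim: ss => //= s ss IH h; rewrite cat_uniq => /and3P[_ /hasPn hs us].
rewrite IH // ?andbT; last by move=> t ht; apply: h; rewrite inE ht orbT.
apply/negP => hss; have := h s (mem_head _ _); case: (s) hss hs => // y s' hss hs _.
have /hs /= : y \in flatten ss by apply/flattenP; exists (y :: s'); rewrite ?mem_head.
by rewrite mem_head.
Qed.

Lemma count_mem_take (T : eqType) (s : seq T) m : uniq s -> m <= size s ->
  count (mem (take m s)) s = m.
Proof.
move=> us hm; rewrite -{2}(cat_take_drop m s) count_cat.
rewrite (eq_in_count (a2 := predT)) => [|t /= ->] //; rewrite count_predT size_takel //.
rewrite (eq_in_count (a2 := pred0)) ?count_pred0 ?addn0 // => t ht /=.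
apply/negbTE; move: us; rewrite -{1}(cat_take_drop m s) cat_uniq => /and3P[_ /hasPn h _].
exact: h.
Qed.

Lemma embed_many_k_cycles n l (x0 : 'I_n) (F G H : graph n) p cs k m e D :
  3 <= l -> l <= k -> 0 < e -> 8 * e <= D -> k + 2 <= D -> 16 * e * D <= n ->
  uniq (p ++ flatten cs) -> (forall u, u \in p ++ flatten cs) -> size p < l ->
  all (fun c => l <= size c) cs -> (forall u w, adj F u w -> comp_adj x0 p cs u w) ->
  m <= count (fun c => size c == k) cs ->
  gadgets k m e G H ->
  (forall s, 0 < s <= 2 * D -> transversal_cycles l s (16 * e) H) ->
  contains (graph_union G H) F.
Proof.
move=> l3 lk e0 eD kD Dn ucs tot pl lcs adjcs hm hgad hT.
pose kc := [seq c <- cs | size c == k].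
pose rest := drop m kc ++ [seq c <- cs | size c != k].
have D0 : 0 < D by apply: leq_trans kD; rewrite addn2.
have skc : m <= size kc by rewrite size_filter.
have prest : perm_eq cs (take m kc ++ rest).
  by rewrite /rest catA cat_take_drop perm_sym perm_filterC.
have [|css hcss Dcss] := @chop_all _ D [seq c <- rest | D <= size c] D0.
  by rewrite filter_all.
(* The gadgets sit on the whole cycles [take m kc]; pieces of long cycles carry none, hence
   [pred0]. *)
have [|||||||g [Z [ts hpl]]] := @plan_gen n l x0 F l3 p cs (take m kc)
    [seq c <- rest | ~~ (D <= size c)] css pred0 k D ucs tot pl lcs adjcs.
- rewrite hcss (perm_trans prest) // perm_cat2l perm_sym.
  by rewrite (perm_trans _ (permEl (perm_filterC (fun c => D <= size c) rest))) // perm_catC.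
- by rewrite (leq_trans lk) // (leq_trans (leq_addr 2 k)) // (leq_trans kD) // leq_pmull.
- exact: leq_trans lk.
- exact: kD.
- by apply/allP => c /mem_take; rewrite mem_filter => /andP[].
- apply/allP => c; rewrite mem_filter -ltnNge => /andP[/ltnW h _].
  by rewrite (leq_trans h) // leq_pmull.
- exact: Dcss.
apply: (embed_plan (x0 := x0) (k := k) (m := m) (D := D) (g := g) (Z := Z) (ts := ts) lk l3 e0 eD Dn _ hgad hT).
by move: hpl; rewrite count_pred0 addn0 size_takel //.
Qed.

(** The numerical hypothesis yields [m] pieces: [p] and the short cycles leave at least 2Dm vertices
    to the pieces, each of which has fewer than 2D. *)
Lemma embed_long_cycles n l (x0 : 'I_n) (F G H : graph n) p cs k m e D :
  3 <= l -> l <= k -> 0 < e -> 8 * e <= D -> k + 2 <= D -> 16 * e * D <= n ->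
  uniq (p ++ flatten cs) -> (forall u, u \in p ++ flatten cs) -> size p < l ->
  all (fun c => l <= size c) cs -> (forall u w, adj F u w -> comp_adj x0 p cs u w) ->
  2 * D * m + l + D * count (fun c => size c < D) cs <= n ->
  gadgets k m e G H ->
  (forall s, 0 < s <= 2 * D -> transversal_cycles l s (16 * e) H) ->
  contains (graph_union G H) F.
Proof.
move=> l3 lk e0 eD kD Dn ucs tot pl lcs adjcs hm hgad hT.
have D0 : 0 < D by apply: leq_trans kD; rewrite addn2.
have [|css hcss Dcss] := @chop_all _ D [seq c <- cs | D <= size c] D0.
  by rewrite filter_all.
set chs := flatten css in Dcss.
pose sh := [seq c <- cs | ~~ (D <= size c)].
have shD : all (fun c => size c <= D) sh.
  by apply/allP => c; rewrite mem_filter -ltnNge => /andP[/ltnW].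
have pcs : perm_eq cs ([::] ++ sh ++ map flatten css).
  by rewrite /= hcss perm_sym perm_catC (permEl (perm_filterC (fun c => D <= size c) cs)).
have pfl : perm_eq (flatten cs) (flatten sh ++ flatten chs).
  by have := perm_flatten pcs; rewrite /= flatten_cat flatten_flatten.
have uch : uniq chs.
  apply: uniq_of_flatten => [t /(allP Dcss)/andP[h _]|]; first exact: leq_trans h.
  move: ucs; rewrite cat_uniq => /and3P[_ _]; rewrite (perm_uniq pfl) cat_uniq.
  by case/and3P.
have hn : n = size p + (size (flatten sh) + size (flatten chs)).
  rewrite -size_cat -(perm_size pfl) -size_cat -(card_uniqP ucs) -[LHS]card_ord.
  by apply: eq_card => u; rewrite tot.
have hsh := size_flatten_le shD.
have hch : size (flatten chs) <= 2 * D * size chs.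
  by apply/size_flatten_le/allP => t /(allP Dcss)/andP[_ /ltnW].
have ssh : size sh = count (fun c => size c < D) cs.
  by rewrite size_filter; apply: eq_count => c; rewrite -ltnNge.
have mch : m <= size chs.
  rewrite -(leq_pmul2l (_ : 0 < 2 * D)) ?muln_gt0 //; rewrite ssh in hsh.
  move: hm hn hsh hch pl; clear.
  by move: (2 * D * m) (2 * D * _) (D * _) (size p) (size _) (size _) => *; lia.
have [||||||g [Z [ts hpl]]] := @plan_gen n l x0 F l3 p cs [::] sh css
    (mem (take m chs)) k D ucs tot pl lcs adjcs pcs.
- by rewrite (leq_trans lk) // (leq_trans (leq_addr 2 k)) // (leq_trans kD) // leq_pmull.
- exact: leq_trans lk.
- exact: kD.
- by [].
- by apply: sub_all shD => c h; rewrite (leq_trans h) // leq_pmull.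
- exact: Dcss.
apply: (embed_plan (x0 := x0) (k := k) (m := m) (D := D) (g := g) (Z := Z) (ts := ts) lk l3 e0 eD Dn _ hgad hT).
by move: hpl; rewrite add0n -/chs count_mem_take.
Qed.

End Embedding.

(** * Universality *)

Section Universality.
Import mathcomp.boot.fintype mathcomp.boot.finset.
Local Set Implicit Arguments.
Local Unset Strict Implicit.
Local Unset Printing Implicit Defensive.

Section Constants.
Local Open Scope nat_scope.
Variables (a l : nat).
Hypothesis a2 : 1 < a.
Hypothesis l3 : 3 <= l.

(* [long_*] : gadgets on pieces of long cycles; [short_*] : gadgets on many
   cycles of one length below [long_D]. *)
Definition long_e := 1536 * a ^ 4.
Definition long_k := 4 * long_e + l.
Definition long_D := 2 * long_k.
Definition long_M := 4 * a * long_k.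
Definition short_M := 16 * a * long_D ^ 2.
Definition short_e := 64 * a ^ 3 * short_M.
Definition short_D := 8 * short_e.

Definition host_ok n (G H : graph n) : Prop :=
  [/\ forall s, s < (2 * short_D).+1 -> 0 < s -> transversal_cycles l s (16 * short_e) H,
      forall s, s < (2 * long_D).+1 -> 0 < s -> transversal_cycles l s (16 * long_e) H,
      gadgets long_k (n %/ long_M) long_e G H
    & forall k, k < long_D -> l <= k -> gadgets k (n %/ short_M) short_e G H].

Lemma long_e_gt0 : 0 < long_e.
Proof. by rewrite /long_e muln_gt0 expn_gt0 (ltnW a2). Qed.

Lemma long_D_gt0 : 0 < long_D.
Proof. by rewrite /long_D /long_k; have := long_e_gt0; move: long_e; lia. Qed.

Lemma short_M_gt0 : 0 < short_M.
Proof.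
rewrite /short_M; move: long_D_gt0; move: long_D => D D0.
by rewrite !muln_gt0 D0 (ltnW a2).
Qed.

Lemma short_M_ge k : k < long_D -> 4 * a * k <= short_M.
Proof.
move=> kD; rewrite /short_M -mulnn; have := long_D_gt0; move: kD; move: long_D => D kD D0.
by apply: (@leq_trans (16 * a * D)); [nia|rewrite leq_mul2l leq_pmulr ?orbT].
Qed.

Lemma short_e_gt0 : 0 < short_e.
Proof.
rewrite /short_e; move: short_M_gt0; move: short_M => M M0.
by rewrite !muln_gt0 M0 (ltnW a2).
Qed.

Lemma short_D_ge : long_D + 2 <= short_D.
Proof.
have h : short_M <= short_e.
  by rewrite /short_e leq_pmull // !muln_gt0 (ltnW a2).
have h1 : long_D <= short_M.
  rewrite /short_M -mulnn mulnA; move: long_D_gt0; move: long_D => D D0.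
  by rewrite leq_pmull // !muln_gt0 D0 (ltnW a2).
have h0 := short_e_gt0.
by rewrite /short_D; move: h h1 h0; move: long_D short_M short_e => x y z; lia.
Qed.

(** The left side is 256 a^4 k, and k <= 6 floor((k+1)/4) for k >= 6; so 1536 = 256 times 6 works
    for every such k. Since [long_e] does not involve k, [long_k] can be taken above 4 [long_e],
    making [long_D] at least 8 [long_e]. *)
Lemma long_gadget_bound : 64 * a ^ 3 * long_M <= long_e * (long_k.+1 %/ 4).
Proof.
have hc : long_k <= 6 * (long_k.+1 %/ 4).
  have := ltn_ceil long_k.+1 (isT : 0 < 4).
  have : 6 <= long_k by rewrite /long_k; have := long_e_gt0; move: long_e => e; lia.
  by move: (long_k.+1 %/ 4) => x; move: long_k => y; lia.
rewrite /long_M /long_e (_ : 64 * _ * _ = 256 * a ^ 4 * long_k); last by ring.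
rewrite (_ : 1536 * a ^ 4 = 256 * a ^ 4 * 6); last by rewrite mulnAC.
by rewrite -[leqRHS]mulnA leq_mul2l hc orbT.
Qed.

(** One gadget per cycle is enough here: [short_e] may be as large as needed, because [short_D] is
    chosen after it. *)
Lemma short_gadget_bound k : 3 <= k -> 64 * a ^ 3 * short_M <= short_e * (k.+1 %/ 4).
Proof. by move=> k3; rewrite leq_pmulr // divn_gt0. Qed.

(** If no length below [long_D] occurs more than [m] times, the short cycles account for at most
    long_D^2 m <= n/16 in the hypothesis of [embed_long_cycles]. The gadget pieces account for at
    most n/a <= n/2, as [long_M] is 2a [long_D], and [l] for n/4; the sum is below n. *)
Lemma host_ok_universal n (G H : graph n) :
  16 * short_e * short_D <= n -> 16 * long_e * long_D <= n -> 4 * l <= n ->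
  host_ok G H -> universal (family2 l n) (graph_union G H).
Proof.
move=> n1 n2 n3 [hT1 hT2 hg2 hg1] F [deg2 girth].
have n0 : 0 < n by apply: leq_trans n3; rewrite muln_gt0 /= (leq_trans _ l3).
have x0 : 'I_n := Ordinal n0.
have [p [cs [ucs tot pl lcs adjcs]]] := decompose x0 l3 deg2 girth.
have hT1' s : 0 < s <= 2 * short_D -> transversal_cycles l s (16 * short_e) H.
  by case/andP => h1 h2; apply: hT1.
have hT2' s : 0 < s <= 2 * long_D -> transversal_cycles l s (16 * long_e) H.
  by case/andP => h1 h2; apply: hT2.
set m := n %/ short_M in hg1.
case: (boolP [exists k : 'I_long_D, m < count (fun c => size c == k) cs]) => [/existsP[k hk]|].
  have lk : l <= k.
    move: (leq_ltn_trans (leq0n m) hk); rewrite -has_count => /hasP[c hc /eqP <-].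
    exact: (allP lcs).
  apply: (embed_many_k_cycles l3 lk short_e_gt0 (leqnn _) _ n1 ucs tot pl lcs adjcs (ltnW hk)) => //.
    by apply: leq_trans short_D_ge; rewrite leq_add2r ltnW.
  exact: hg1.
rewrite negb_exists => /forallP hno.
have lk : l <= long_k by rewrite /long_k leq_addl.
apply: (embed_long_cycles l3 lk long_e_gt0 _ _ n2 ucs tot pl lcs adjcs _ hg2 hT2').
- by rewrite /long_D /long_k mulnDr mulnA leq_addr.
- have := leq_trans l3 lk; rewrite /long_D; move: long_k; lia.
have hcnt := @count_size_lt _ cs long_D m _.
have {}hcnt : count (fun c => size c < long_D) cs <= long_D * m.
  by apply: hcnt => k kD; have := hno (Ordinal kD); rewrite -leqNgt.
have hm2 : 4 * (2 * long_D * (n %/ long_M)) <= 2 * n.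
  have := leq_trunc_div n long_M; rewrite /long_M /long_D.
  move: (n %/ (4 * a * long_k)) => q; move: long_k => k h.
  have h' : 2 * (k * q) <= a * (k * q) by rewrite leq_mul2r a2 orbT.
  by move: h h'; clear; nia.
have hm1 : 16 * (long_D * (long_D * m)) <= n.
  have := leq_trunc_div n short_M; rewrite -/m /short_M -mulnn.
  apply: leq_trans; rewrite (_ : m * _ = a * (16 * (long_D * (long_D * m)))); last by ring.
  by rewrite leq_pmull // ltnW.
have hD : 16 * (long_D * count (fun c => size c < long_D) cs) <= n.
  by apply: leq_trans hm1; rewrite leq_mul2l /= leq_mul2l hcnt orbT.
by move: hm2 hD n3; clear; move: (long_D * _) (2 * long_D * _) => x y; lia.
Qed.

End Constants.

Lemma bigmin_leq (T : eqType) (r : seq T) (f : T -> nat) m x : x \in r ->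
  (\big[minn/m]_(i <- r) f i <= f x)%N.
Proof.
elim: r => // y r IH; rewrite inE big_cons => /predU1P[->|/IH h]; first exact: geq_minl.
exact: leq_trans (geq_minr _ _) h.
Qed.

Lemma min_degree_leq n (G : graph n) v : (min_degree G <= #|nbr G v|)%N.
Proof. by rewrite cardsE; apply: bigmin_leq; apply: mem_index_enum. Qed.

Variable R : realType.
Variables (p : nat -> R) (l a : nat) (Ga : forall n, graph n).
Hypothesis p01 : forall n, 0 <= p n <= 1.
Hypothesis l3 : (3 <= l)%N.
Hypothesis a2 : (1 < a)%N.
Hypothesis p_omega : forall C : R,
  \forall n \near \oo%classic, C <= p n * n%:R `^ ((l%:R - 1) / l%:R).
Hypothesis Ga_nbr : \forall n \near \oo%classic, forall v, (n <= a * #|nbr (Ga n) v|)%N.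

Lemma aas_host_ok : aas p (fun n H => host_ok a l (Ga n) H).
Proof.
have a0 := ltnW a2.
have aasT e D : (0 < e)%N -> aas p (fun n (H : graph n) => forall s, (s < D)%N -> (0 < s)%N ->
    transversal_cycles l s (16 * e) H).
  move=> e0.
  apply: (aas_forall p01 (A := fun s n (H : graph n) => (0 < s)%N -> transversal_cycles l s (16 * e) H)).
  move=> s _; case: (posnP s) => [->|s0].
    by apply: aas_imp (aas_transversal p01 l3 p_omega (isT : (0 < 1)%N) (isT : (0 < 1)%N)) => //; apply: nearW.
  have e16 : (0 < 16 * e)%N by rewrite muln_gt0.
  by apply: aas_imp (aas_transversal p01 l3 p_omega s0 e16) => //; apply: nearW.
have h1 := aasT _ (2 * short_D a l).+1 (short_e_gt0 a2 l3).
have h2 := aasT _ (2 * long_D a l).+1 (long_e_gt0 a2).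
have lk : (l <= long_k a l)%N by rewrite /long_k leq_addl.
have h3 := aas_gadgets p01 l3 p_omega a0 Ga_nbr lk (leqnn _) (long_gadget_bound a2 l3).
have h4 : aas p (fun n H => forall k, (k < long_D a l)%N -> (l <= k)%N ->
    gadgets k (n %/ short_M a l) (short_e a l) (Ga n) H).
  apply: (aas_forall p01 (A := fun k n H => (l <= k)%N ->
    gadgets k (n %/ short_M a l) (short_e a l) (Ga n) H)) => k kD.
  case: (leqP l k) => lk'; last first.
    by apply: aas_imp h1 => //; apply: nearW.
  have h := aas_gadgets p01 l3 p_omega a0 Ga_nbr lk' (short_M_ge a2 l3 kD)
    (short_gadget_bound a l (leq_trans l3 lk')).
  by apply: aas_imp h => //; apply: nearW.
apply: aas_imp (aas_and p01 (aas_and p01 h1 h2) (aas_and p01 h3 h4)) => //.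
by apply: nearW => n H [[? ?] [? ?]].
Qed.

Lemma aas_universal :
  aas p (fun n (H : graph n) => universal (family2 l n) (graph_union (Ga n) H)).
Proof.
apply: aas_imp aas_host_ok => //; near=> n => H; apply: host_ok_universal => //.
- by near: n; exact: nbhs_infty_ge.
- by near: n; exact: nbhs_infty_ge.
- by near: n; exact: nbhs_infty_ge.
Unshelve. all: by end_near. Qed.

End Universality.

Local Open Scope classical_set_scope.

Theorem theorem1p2 (R : realType) (alpha : R) (l : nat) (p : nat -> R)
    (Ga : forall n : nat, graph n)
    (alpha_gt0 : 0 < alpha)
    (l_ge3 : (3 <= l)%N)
    (p_prob : forall n : nat, 0 <= p n <= 1)
    (p_omega : p n * n%:R `^ ((l%:R - 1) / l%:R) @[n --> \oo] --> +oo)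
    (Ga_min_degree :
      \forall n \near \oo, alpha * n%:R <= (min_degree (Ga n))%:R) :
  gnp_prob (p n)
    [set H : graph n | universal (family2 l n) (graph_union (Ga n) H)]
    @[n --> \oo] --> (1 : R).
Proof.
(* The increment by 2 ensures [1 < a], so that the gadget pieces occupy at most half of the
   vertices. *)
pose a := (Num.bound alpha^-1).+2.
have ha : alpha^-1 <= a%:R.
  apply: ltW; apply: lt_le_trans (archi_boundP _) _; first by rewrite invr_ge0 ltW.
  by rewrite ler_nat /a; apply: leq_trans (leqnSn _) (leqnSn _).
have hdeg : \forall n \near \oo, forall v, (n <= a * #|nbr (Ga n) v|)%N.
  near=> n => v; rewrite -(ler_nat R) natrM.
  apply: (@le_trans _ _ (a%:R * (min_degree (Ga n))%:R)); last first.
    by rewrite ler_wpM2l // ler_nat min_degree_leq.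
  apply: (@le_trans _ _ (alpha^-1 * (alpha * n%:R))); first by rewrite mulKf // gt_eqF.
  apply: ler_pM => //; [by rewrite invr_ge0 ltW|by rewrite mulr_ge0 // ltW|].
  by near: n.
have homega : forall C : R, \forall n \near \oo, C <= p n * n%:R `^ ((l%:R - 1) / l%:R).
  by apply/cvgryPge.
have hU := @aas_universal R p l a Ga p_prob l_ge3 isT homega hdeg.
apply/cvgrPdist_le => e e0; near=> n.
rewrite gnp_probC opprB addrC subrK ger0_norm.
  by near: n; exact: hU.
by rewrite gnp_probE sumr_ge0 // => H _; case: ifP => // _; apply: gnp_mass_ge0.
Unshelve. all: by end_near. Qed.
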